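(* Let $F=\alpha\,\phi\big(b^2,\frac{\beta}{\alpha}\big)$ be a non-Riemannian general $(\alpha,\beta)$-metric on an $n$-dimensional manifold with $n\ge3$, and suppose that $\beta$ is not parallel with respect to $\alpha$. Let $c=c(b^2)$, $\mu=\mu(b^2)$, $\nu=\nu(b^2)$ be $C^\infty$ functions of $b^2$. Then the general solution of the PDE $$\big\{b^3[(1-c)s^2+cb^2]+[(\nu-\mu)s^2-\nu b^2](b^2-s^2)\big\}\phi_{22}=2b^5(\phi_1-s\phi_{12})-[(\nu-\mu)s^2-\nu b^2](\phi-s\phi_2)$$ is given by $$\phi=s\Big\{h(b^2)-\xi(b^2)\int\frac{\Phi(\zeta(b^2,s))}{s^2\sqrt{b^2-s^2}}\,ds\Big\},$$ where $$\zeta(b^2,s)=\frac{b^2-s^2}{e^{\int\frac{(1-c)b+\mu}{b^3}\,db^2}+(b^2-s^2)\int\frac{\nu-\mu}{b^5}\,e^{\int\frac{(1-c)b+\mu}{b^3}\,db^2}\,db^2},\qquad \xi(b^2)=e^{\int\frac{1-c}{2b^2}\,db^2},$$ $h=h(b^2)$ is a $C^\infty$ function of $b^2$, and $\Phi$ is a $C^\infty$ function of $\zeta$. Moreover, for the positive definiteness of $F$, $\Phi$ satisfies $$\frac{\Phi}{\sqrt{b^2-s^2}}>0,\qquad \Phi'\sqrt{b^2-s^2}>0,$$ where $\Phi'$ is the derivative of $\Phi$ with respect to the variable $\zeta$.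
   Context: A Finsler metric on a smooth manifold $M$ is a function $F:TM\to[0,\infty)$, smooth away from the zero section, with $F(x,y)=0$ iff $y=0$, $F(x,\lambda y)=\lambda F(x,y)$ for $\lambda>0$, and $g_{ij}=\frac12[F^2]_{y^iy^j}$ positive definite for $y\neq0$; it is Riemannian if $g_{ij}$ depends only on $x$. A general $(\alpha,\beta)$-metric is a Finsler metric of the form $F=\alpha\,\phi(b^2,s)$, $s=\beta/\alpha$, where $\alpha=\sqrt{a_{ij}(x)y^iy^j}$ is a Riemannian metric, $\beta=b_i(x)y^i$ is a 1-form, $b=\|\beta_x\|_\alpha$ is the norm of $\beta$ with respect to $\alpha$, and $\phi=\phi(b^2,s)$ is a positive $C^\infty$ function, with $|s|\le b$. $\beta$ is parallel if its covariant derivative with respect to the Levi-Civita connection of $\alpha$ vanishes. $\phi_1$ and $\phi_2$ are the partial derivatives of $\phi$ with respect to its first variable $b^2$ and its second variable $s$ (the two treated as independent variables); $\phi_{12},\phi_{22}$ are the corresponding second partial derivatives. $\int(\cdot)\,db^2$ denotes an antiderivative with respect to the variable $b^2$ (with the same choice for the repeated exponent), and $\int(\cdot)\,ds$ an antiderivative with respect to $s$ with $b^2$ held fixed. The formulas are understood where $b>0$, $|s|<b$ and the displayed expressions are defined, the value of $\phi$ at $s=0$ being obtained by continuous extension.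
   Formalization: One h and one Φ on all of |s|<b fail (c=μ=ν=0, φ=1−εs³/b³ needs different Φ for s>0 and s<0), so the formula is proved locally where s≠0 and ζ is defined, with a single h and Φ on open sets with connected level sets of ζ and interval s-sections. *)

(* Defs.v *)
From HB Require Import structures.
From mathcomp Require Import all_boot all_order all_algebra.
From mathcomp Require Import all_classical all_reals all_analysis.
Set Implicit Arguments.
Unset Strict Implicit.
Unset Printing Implicit Defensive.
Import Order.TTheory GRing.Theory Num.Theory.
Import numFieldNormedType.Exports.
Local Open Scope classical_set_scope.
Local Open Scope ring_scope.

(* C^k in the Frechet sense; U is meant to be open. *)
Fixpoint Ck (R : realType) (V W : normedModType R) (k : nat) (U : set V)
    (f : V -> W) : Prop :=
  match k with
  | 0 => forall x, U x -> {for x, continuous f}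
  | k'.+1 => (forall x, U x -> differentiable f x) /\
             (forall v : V, Ck k' U ('D_v f : V -> W))
  end.

Definition smooth_on (R : realType) (V W : normedModType R) (U : set V)
    (f : V -> W) : Prop :=
  forall k : nat, Ck k U f.

(* A manifold given by a smooth atlas (not necessarily maximal).  Only the
   values of [coord a] on [cdom a] and of [param a] on the image of the chart
   are meaningful.  Coordinate vectors are row vectors. *)
Record manifold (R : realType) (n : nat) := Manifold {
  pt :> topologicalType;
  chart : Type;
  cdom : chart -> set pt;
  coord : chart -> pt -> 'rV[R]_n;
  param : chart -> 'rV[R]_n -> pt;
  pt_hausdorff : hausdorff_space pt;
  pt_second_countable : @second_countable pt;
  cdom_cover : forall p, exists a, cdom a p;
  cdom_open : forall a, open (cdom a);
  cimg_open : forall a, open (coord a @` cdom a);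
  coordK : forall a p, cdom a p -> param a (coord a p) = p;
  coord_continuous : forall a p, cdom a p -> {for p, continuous (coord a)};
  param_continuous : forall a x, (coord a @` cdom a) x ->
    {for x, continuous (param a)};
  transition_smooth : forall a b,
    smooth_on (coord a @` (cdom a `&` cdom b)) (coord b \o param a)
}.

Section Geometry.
Variables (R : realType) (n : nat) (M : manifold R n).

Definition cimg (a : chart M) : set 'rV[R]_n := coord a @` cdom a.

Definition overlap (a b : chart M) : set 'rV[R]_n :=
  coord a @` (cdom a `&` cdom b).

Definition trans (a b : chart M) : 'rV[R]_n -> 'rV[R]_n :=
  coord b \o param a.

(* Change of the components of a tangent vector at the point of coordinates x
   in the chart a. *)
Definition push (a b : chart M) (x v : 'rV[R]_n) : 'rV[R]_n :=
  'd (trans a b) x v.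

Definition pd (i : 'I_n) (f : 'rV[R]_n -> R) : 'rV[R]_n -> R :=
  'D_(delta_mx 0 i) f.

Definition bilin (A : 'M[R]_n) (u v : 'rV[R]_n) : R := (u *m A *m v^T) 0 0.

Definition pairing (w v : 'rV[R]_n) : R := (w *m v^T) 0 0.

Definition posdef (A : 'M[R]_n) : Prop := forall v, v != 0 -> 0 < bilin A v v.

(* Tensor fields are families of components, one for each chart, subject to
   the transformation rule on overlaps. *)
Definition riemannian_metric (al : chart M -> 'rV[R]_n -> 'M[R]_n) : Prop :=
  [/\ forall a, smooth_on (cimg a) (al a),
      forall a x, cimg a x -> (al a x)^T = al a x,
      forall a x, cimg a x -> posdef (al a x) &
      forall a b x, overlap a b x -> forall u v,
        bilin (al a x) u v
        = bilin (al b (trans a b x)) (push a b x u) (push a b x v)].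

Definition one_form (be : chart M -> 'rV[R]_n -> 'rV[R]_n) : Prop :=
  (forall a, smooth_on (cimg a) (be a)) /\
  (forall a b x, overlap a b x -> forall v,
     pairing (be a x) v = pairing (be b (trans a b x)) (push a b x v)).

(* g_ij(x, y) of a function F on TM, in the chart a. *)
Definition fundamental_tensor (F : chart M -> 'rV[R]_n -> 'rV[R]_n -> R)
    (a : chart M) (x y : 'rV[R]_n) : 'M[R]_n :=
  \matrix_(i, j) (2^-1 * pd j (pd i (fun y' => F a x y' ^+ 2)) y).

Definition finsler (F : chart M -> 'rV[R]_n -> 'rV[R]_n -> R) : Prop :=
  (forall a b x, overlap a b x -> forall y,
     F a x y = F b (trans a b x) (push a b x y)) /\
  (forall a, smooth_on [set p : 'rV[R]_n * 'rV[R]_n | cimg a p.1 /\ p.2 != 0]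
                       (fun p => F a p.1 p.2)) /\
  (forall a x, cimg a x ->
     [/\ forall y, 0 <= F a x y,
         forall y, F a x y = 0 <-> y = 0,
         forall (l : R) y, 0 < l -> F a x (l *: y) = l * F a x y &
         forall y, y != 0 -> posdef (fundamental_tensor F a x y)]).

Definition is_riemannian (F : chart M -> 'rV[R]_n -> 'rV[R]_n -> R) : Prop :=
  forall a x, cimg a x -> forall y y', y != 0 -> y' != 0 ->
    fundamental_tensor F a x y = fundamental_tensor F a x y'.

Variables (al : chart M -> 'rV[R]_n -> 'M[R]_n)
          (be : chart M -> 'rV[R]_n -> 'rV[R]_n).

Definition alpha (a : chart M) (x y : 'rV[R]_n) : R :=
  Num.sqrt (bilin (al a x) y y).

Definition beta (a : chart M) (x y : 'rV[R]_n) : R := pairing (be a x) y.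

(* b^2 = a^{ij} b_i b_j, the squared norm of the 1-form with respect to alpha *)
Definition bsq (a : chart M) (x : 'rV[R]_n) : R :=
  bilin (invmx (al a x)) (be a x) (be a x).

Definition christoffel (a : chart M) (x : 'rV[R]_n) (k i j : 'I_n) : R :=
  2^-1 * \sum_l invmx (al a x) k l *
    (pd i (fun x' => al a x' j l) x + pd j (fun x' => al a x' i l) x
     - pd l (fun x' => al a x' i j) x).

Definition cov_deriv (a : chart M) (x : 'rV[R]_n) (i j : 'I_n) : R :=
  pd j (fun x' => be a x' 0 i) x - \sum_k christoffel a x k i j * be a x 0 k.

Definition parallel : Prop :=
  forall a x, cimg a x -> forall i j, cov_deriv a x i j = 0.

(* I is the set of admissible values of b^2.  Smoothness of phi on the
   closed-up region |s| <= b is smoothness on a neighbourhood of it. *)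
Definition general_ab_metric (I : set R) (phi : R -> R -> R)
    (F : chart M -> 'rV[R]_n -> 'rV[R]_n -> R) : Prop :=
  [/\ finsler F,
      riemannian_metric al /\ one_form be,
      (exists O : set (R * R),
         [/\ open O,
             forall t s, I t -> s ^+ 2 <= t -> O (t, s) &
             smooth_on O (fun p => phi p.1 p.2)]) /\
      (forall t s, I t -> s ^+ 2 <= t -> 0 < phi t s) &
      forall a x, cimg a x -> I (bsq a x) /\
        forall y, y != 0 ->
          F a x y = alpha a x y * phi (bsq a x) (beta a x y / alpha a x y)].

End Geometry.

Section PDE.
Variable R : realType.
Implicit Types (I : set R) (U : set (R * R)) (phi G : R -> R -> R).
Implicit Types (c mu nu P Q K h Phi : R -> R) (t s : R).

(* Functions of (b^2, s) take t = b^2 as their first argument. *)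
Definition d1 phi : R -> R -> R := fun t s => derive1 (fun t' => phi t' s) t.
Definition d2 phi : R -> R -> R := fun t s => derive1 (phi t) s.

Definition pos_part I : set R := [set t | I t /\ 0 < t].

Definition pde_at c mu nu phi t s : Prop :=
  let b := Num.sqrt t in
  let A := (nu t - mu t) * s ^+ 2 - nu t * b ^+ 2 in
  (b ^+ 3 * ((1 - c t) * s ^+ 2 + c t * b ^+ 2) + A * (b ^+ 2 - s ^+ 2))
    * d2 (d2 phi) t s
  = 2 * b ^+ 5 * (d1 phi t s - s * d2 (d1 phi) t s)
    - A * (phi t s - s * d2 phi t s).

Definition pde_on U c mu nu phi : Prop :=
  forall t s, U (t, s) -> pde_at c mu nu phi t s.

Definition antiderivative (J : set R) (F f : R -> R) : Prop :=
  forall t, J t -> is_derive t 1 F (f t).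

(* P = int ((1-c)b+mu)/b^3 db^2,  K = int (nu-mu)/b^5 e^P db^2  and
   Q = int (1-c)/(2b^2) db^2, with arbitrary constants of integration. *)
Definition integrals I c mu nu P K Q : Prop :=
  [/\ antiderivative (pos_part I) P
        (fun t => ((1 - c t) * Num.sqrt t + mu t) / Num.sqrt t ^+ 3),
      antiderivative (pos_part I) K
        (fun t => (nu t - mu t) / Num.sqrt t ^+ 5 * expR (P t)) &
      antiderivative (pos_part I) Q (fun t => (1 - c t) / (2 * t))].

Definition zeta_den P K t s : R := expR (P t) + (t - s ^+ 2) * K t.

Definition zeta P K t s : R := (t - s ^+ 2) / zeta_den P K t s.

Definition xi Q t : R := expR (Q t).

Definition pde_dom I : set (R * R) :=
  [set p | pos_part I p.1 /\ `|p.2| < Num.sqrt p.1].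

(* where zeta and the integrand Phi(zeta) / (s^2 sqrt(b^2 - s^2)) are defined *)
Definition formula_dom I P K : set (R * R) :=
  [set p | [/\ pde_dom I p, p.2 != 0 & zeta_den P K p.1 p.2 != 0]].

(* phi is given on U by the solution formula with data h and Phi; G is the
   antiderivative with respect to s. *)
Definition formula_on U P K Q phi h Phi G : Prop :=
  [/\ smooth_on [set t | exists s, U (t, s)] h,
      smooth_on [set z | exists t s, U (t, s) /\ z = zeta P K t s] Phi,
      forall t s, U (t, s) ->
        is_derive s 1 (G t)
          (Phi (zeta P K t s) / (s ^+ 2 * Num.sqrt (t - s ^+ 2))) &
      forall t s, U (t, s) -> phi t s = s * (h t - xi Q t * G t s)].

Definition has_formula U P K Q phi : Prop :=
  exists h Phi G, formula_on U P K Q phi h Phi G.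

(* The level sets of zeta are the (projected) characteristic curves of the
   PDE; the solution formula can have a single Phi and a single h on U only if
   U does not disconnect them, nor the lines b^2 = const. *)
Definition unobstructed U P K : Prop :=
  (forall z, connected (U `&` [set p | zeta P K p.1 p.2 = z])) /\
  (forall t, is_interval [set s | U (t, s)]).

End PDE.

(* Main.v *)
Require Import Defs.
From HB Require Import structures.
From mathcomp Require Import all_boot all_order all_algebra.
From mathcomp Require Import all_classical all_reals all_analysis.
From mathcomp Require Import ring.
Import Order.TTheory GRing.Theory Num.Theory.
Import numFieldNormedType.Exports.
Local Open Scope classical_set_scope.
Local Open Scope ring_scope.

(** Write t = b^2, w = t - s^2 and psi = phi - s phi_2 ([legendre]).  Since
    psi_s = - s phi_22 and, by the symmetry of second derivatives,
    psi_t = phi_1 - s phi_12, the PDE multiplied by s is a linear equation of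
    the first order in psi, with characteristic direction
    ds/dt = B / (2 s b^5), where B is the coefficient of phi_22.  Along the
    characteristics 1 / zeta = e^P / w + K is constant, so for a constant z
    they are the curves
      s^2 = t - W,   W = z e^P / (1 - z K)
    ([level_w], [level_s]).  The equation has a term of order zero; it
    disappears for the rescaled unknown Psi = psi sqrt(w) / xi ([reduced]).
    Explicitly, the derivative of Psi along a level curve of zeta is a nonzero
    multiple of the difference of the two sides of the PDE
    ([is_derive_reduced]), so that phi solves the PDE exactly when Psi is
    constant along these curves.

    This one computation serves both directions.  If phi is given by the
    formula, then differentiating it in s gives Psi = Phi(zeta), which is
    constant on level curves, hence the PDE ([pde_of_formula]).  Conversely,
    if Psi only depends on zeta, let Phi(z) be its value on the level z; then
    psi = xi Phi(zeta) / sqrt(w), and since psi = - s^2 (phi / s)_s, the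
    function - phi / (s xi) is an antiderivative of the integrand and the
    formula holds with h = 0 ([has_formula_of_level_cst]).  Smoothness of Phi
    follows by restricting Psi to a line t = const, on which zeta is a local
    coordinate.  That Psi only depends on zeta is clear near a point, where
    the levels are arcs, and follows from connectedness in general.  The
    points where s = 0 or zeta is undefined are isolated on each line
    t = const, so the PDE extends to them by continuity ([pde_extend]).

    For the inequalities, fix a point of the manifold, and let y and e be
    alpha-orthonormal with beta(y) = s and beta(e) = kappa.  Positivity of the
    fundamental tensor at y in the direction e + k y, with k chosen so that
    this direction is orthogonal to y for the tensor, reads
    psi + kappa^2 phi_22 > 0 ([gab_convex]).  Here kappa can be 0 or sqrt(w),
    because n >= 3 ([adapted_frame]), and the formula turns the two resulting
    inequalities into those for Phi and Phi' ([legendre_formula],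
    [derive1_formula]). *)

Set Implicit Arguments.
Unset Strict Implicit.
Unset Printing Implicit Defensive.

(** * Calculus of C^k maps *)

Lemma near_eq_differentiable (R : realType) (V W : normedModType R)
    (f g : V -> W) (x : V) :
  (\near x, f x = g x) -> differentiable f x -> differentiable g x.
Proof.
move=> fg dfx; have [dfc fE] := (diff_locallyP x f).1 dfx.
have gE : g \o shift x = cst (g x) + 'd f x +o_ 0 id.
  apply/eqaddoP => e e0; move/eqaddoP: fE => /(_ e e0).
  have := fg; rewrite (near_shift 0) subr0 => fg0.
  apply: filterS2 fg0 => y /= fgy.
  have fgx : f x = g x by exact: nbhs_singleton fg.
  by rewrite -![(_ + _ : _ -> _) _]/(_ + _) -![(- _ : _ -> _) _]/(- _) /= fgy fgx.
apply/diff_locallyP; have -> := diff_unique dfc gE; by split.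
Qed.

(** Rewriting with this equivalence keeps the recursive definition of [Ck]
    folded. *)
Lemma CkSP (R : realType) (V W : normedModType R) k (U : set V)
    (f : V -> W) :
  Ck k.+1 U f <->
  (forall x, U x -> differentiable f x) /\ (forall v, Ck k U ('D_v f)).
Proof. by []. Qed.

(** [Ck k U] tests derivatives at the points of [U] only, but these see a
    neighbourhood; hence agreement near each point, not on [U], is what is
    needed when [U] is not open. *)
Lemma Ck_near (R : realType) (V W : normedModType R) k (U : set V)
    (f g : V -> W) :
  (forall x, U x -> \near x, f x = g x) -> Ck k U f -> Ck k U g.
Proof.
elim: k f g => [|k IH] f g fg.
  move=> cf x Ux; have fgx : f x = g x := nbhs_singleton (fg _ Ux).
  rewrite /prop_for /continuous_at -fgx.
  by apply: cvg_trans (cf x Ux); apply: near_eq_cvg; exact: fg.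
move=> /CkSP[df Df]; apply/CkSP; split=> [x Ux|v].
  by apply: near_eq_differentiable (df x Ux); exact: fg.
apply: IH (Df v) => x Ux.
by apply: filterS (near_join (fg x Ux)) => y; exact: near_eq_derive.
Qed.

Lemma Ck_sub (R : realType) (V W : normedModType R) k (U U' : set V)
    (f : V -> W) : U' `<=` U -> Ck k U f -> Ck k U' f.
Proof.
move=> U'U; elim: k f => [|k IH] f; first by move=> cf x /U'U; exact: cf.
by move=> /CkSP[df Df]; apply/CkSP; split=> [x /U'U|v]; [exact: df|exact: IH].
Qed.

Lemma CkS (R : realType) (V W : normedModType R) k (U : set V)
    (f : V -> W) : Ck k.+1 U f -> Ck k U f.
Proof.
elim: k f => [|k IH] f /CkSP[df Df].
  by move=> x Ux; exact: differentiable_continuous (df x Ux).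
by apply/CkSP; split=> // v; exact: IH.
Qed.

Lemma Ck_ext (R : realType) (V W : normedModType R) k (U : set V)
    (f g : V -> W) :
  open U -> (forall x, U x -> f x = g x) -> Ck k U f -> Ck k U g.
Proof.
move=> oU fg; apply: Ck_near => x Ux.
by apply: filterS (open_nbhs_nbhs (conj oU Ux)).
Qed.

Lemma Ck_cst (R : realType) (V W : normedModType R) k (U : set V) (a : W) :
  Ck k U (cst a : V -> W).
Proof.
elim: k a => [|k IH] a; first by move=> x _; exact: cvg_cst.
apply/CkSP; split=> [x _|v]; first exact: differentiable_cst.
by rewrite (_ : 'D_v _ = cst 0) //; apply/funext => x; exact: derive_cst.
Qed.

Lemma CkD (R : realType) (V W : normedModType R) k (U : set V)
    (f g : V -> W) : open U -> Ck k U f -> Ck k U g -> Ck k U (f \+ g).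
Proof.
move=> oU; elim: k f g => [|k IH] f g.
  by move=> cf cg x Ux; apply: cvgD; [exact: cf|exact: cg].
move=> /CkSP[df Df] /CkSP[dg Dg]; apply/CkSP; split=> [x Ux|v].
  by apply: differentiableD; [exact: df|exact: dg].
apply: Ck_ext (IH _ _ (Df v) (Dg v)) => // x Ux.
by rewrite deriveD //; apply: diff_derivable; [exact: df|exact: dg].
Qed.

Lemma CkM (R : realType) (V : normedModType R) k (U : set V)
    (f g : V -> R) : open U -> Ck k U f -> Ck k U g -> Ck k U (f \* g).
Proof.
move=> oU; elim: k f g => [|k IH] f g.
  by move=> cf cg x Ux; apply: cvgM; [exact: cf|exact: cg].
move=> cf cg; have /CkSP[df Df] := cf; have /CkSP[dg Dg] := cg.
apply/CkSP; split=> [x Ux|v].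
  by apply: differentiableM; [exact: df|exact: dg].
have H := CkD oU (IH _ _ (CkS cf) (Dg v)) (IH _ _ (CkS cg) (Df v)).
apply: (Ck_ext oU _ H) => x Ux.
by rewrite deriveM //; apply: diff_derivable; [exact: df|exact: dg].
Qed.

(** By the chain rule the derivatives are products of functions of the same kind,
    so the induction on [k] closes up thanks to [CkM]. *)
Lemma Ck_comp (R : realType) (V : normedModType R) k (U : set V) (U' : set R)
    (f : R -> R) (g : V -> R) : open U -> (forall x, U x -> U' (g x)) ->
  Ck k U' f -> Ck k U g -> Ck k U (f \o g).
Proof.
move=> oU gU; elim: k f g gU => [|k IH] f g gU.
  by move=> cf cg x Ux; apply: continuous_comp; [exact: cg|exact/cf/gU].
move=> /CkSP[df Df] cg; have /CkSP[dg Dg] := cg; apply/CkSP; split=> [x Ux|v].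
  by apply: differentiable_comp; [exact: dg|exact/df/gU].
have H1 := IH _ _ gU (Df 1) (CkS cg).
have H2 := CkM oU H1 (Dg v).
apply: (Ck_ext oU _ H2) => x Ux.
have dgx := dg _ Ux; have dfx := df _ (gU _ Ux).
have dc : differentiable (f \o g) x by exact: differentiable_comp.
rewrite (deriveE v dc) (diff_comp dgx dfx) /= (deriveE v dgx) (deriveE _ dfx).
rewrite -[X in _ = 'd _ _ X]mulr1 -[X in _ = 'd _ _ X]/(_ *: _) linearZ /=.
by rewrite mulrC.
Qed.

Lemma is_derive_line (R : realType) (x v : R) (f : R -> R) (d : R) :
  is_derive x 1 f d -> 'D_v f x = v * d.
Proof.
move=> [/derivable1_diffP df <-].
by rewrite !deriveE // -[in LHS](mulr1 v) -[X in 'd _ _ X]/(_ *: _) linearZ.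
Qed.

Lemma Ck_inv (R : realType) k : Ck k [set x : R | x != 0] (@GRing.inv R).
Proof.
have o : open [set x : R | x != 0].
  rewrite (_ : [set x | _] = ~` [set 0]); first exact/closed_openC/closed_eq.
  by apply/seteqP; split => x /= /eqP.
elim: k => [|k IH]; first by move=> x x0; exact: inv_continuous.
apply/CkSP; split=> [x x0|v]; first exact: differentiable_Rinv.
have H := CkM o (Ck_cst k _ (- v : R)) (CkM o IH IH).
apply: (Ck_ext o _ H) => x x0 /=.
rewrite (is_derive_line v (is_deriveV x0 (is_derive_id x 1))).
by rewrite /= /cst expr2 invfM [_ *: 1]mulr1 mulrN mulNr.
Qed.

Lemma Ck_sqrt (R : realType) k : Ck k [set x : R | 0 < x] Num.sqrt.
Proof.
have o : open [set x : R | 0 < x] by exact: open_gt.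
elim: k => [|k IH]; first by move=> x x0; exact: sqrt_continuous.
apply/CkSP; split=> [x x0|v].
  by apply/derivable1_diffP; have [] := is_derive1_sqrt x0.
have sq x : 0 < x :> R -> [set x : R | x != 0] (Num.sqrt x).
  by move=> x0 /=; rewrite gt_eqF // sqrtr_gt0.
have H := CkM o (Ck_cst k _ (v / 2 : R)) (Ck_comp o sq (Ck_inv R k) IH).
apply: (Ck_ext o _ H) => x x0 /=.
by rewrite (is_derive_line v (is_derive1_sqrt x0)) /cst invfM mulrA.
Qed.

Lemma differentiable_id (R : realType) (V : normedModType R) (x : V) :
  differentiable (fun y : V => y) x.
Proof. exact: (ex_diff (is_diff_def := is_diff_id x)). Qed.

Lemma derive_slice1 (R : realType) (V W Z : normedModType R) (f : V * W -> Z)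
    (x v : V) (y : W) : 'D_v (fun x => f (x, y)) x = 'D_(v, 0) f (x, y).
Proof.
rewrite /derive.
rewrite [X in _ = lim (X @ _)](_ : _ =
  fun h => h^-1 *: (((fun x => f (x, y)) \o shift x) (h *: v) - f (x, y))) //.
apply/funext => h /=; congr (_ *: (f _ - _)).
rewrite -[h *: (v, 0)]/(h *: v, h *: 0) -[_ + (x, y)]/(_ + x, _ + y).
by rewrite scaler0 add0r.
Qed.

Lemma derive_slice2 (R : realType) (V W Z : normedModType R) (f : V * W -> Z)
    (x : V) (y v : W) : 'D_v (fun y => f (x, y)) y = 'D_(0, v) f (x, y).
Proof.
rewrite /derive.
rewrite [X in _ = lim (X @ _)](_ : _ =
  fun h => h^-1 *: (((fun y => f (x, y)) \o shift y) (h *: v) - f (x, y))) //.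
apply/funext => h /=; congr (_ *: (f _ - _)).
rewrite -[h *: (0, v)]/(h *: 0, h *: v) -[_ + (x, y)]/(_ + x, _ + y).
by rewrite scaler0 add0r.
Qed.

Lemma Ck_slice (R : realType) (V W Z : normedModType R) k (U : set (V * W))
    (f : V * W -> Z) (x : V) :
  Ck k U f -> Ck k [set y | U (x, y)] (fun y => f (x, y)).
Proof.
elim: k f => [|k IH] f.
  move=> cf y Uxy; apply: (@continuous_comp _ _ _ (fun y => (x, y)) f).
    by apply: cvg_pair; [exact: cvg_cst|exact: cvg_id].
  exact: cf.
move=> /CkSP[df Df]; apply/CkSP; split=> [y Uxy|v].
  have dxy : differentiable (fun y : W => (x, y)) y.
    exact: (differentiable_pair (differentiable_cst x y) (differentiable_id y)).
  exact: (differentiable_comp dxy (df _ Uxy)).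
have E : 'D_v (fun y => f (x, y)) = fun y => 'D_(0, v) f (x, y).
  by apply/funext => y; exact: derive_slice2.
rewrite E.
exact: (IH _ (Df (0, v))).
Qed.

Lemma Ck_id (R : realType) (V : normedModType R) k (U : set V) :
  Ck k U (fun x : V => x).
Proof.
case: k => [|k]; first by move=> x _; exact: cvg_id.
apply/CkSP; split=> [x _|v]; first exact: differentiable_id.
rewrite (_ : 'D_v _ = cst v); first exact: Ck_cst.
by apply/funext => x; exact: derive_id.
Qed.

Lemma CkN (R : realType) (V : normedModType R) k (U : set V) (f : V -> R) :
  open U -> Ck k U f -> Ck k U (fun x => - f x).
Proof.
move=> oU cf; have := CkM oU (Ck_cst k U (-1 : R)) cf.
by apply: (Ck_ext oU) => x _ /=; rewrite mulN1r.
Qed.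

Lemma Ck_locally (R : realType) (V W : normedModType R) k (U : set V)
    (f : V -> W) :
  (forall x, U x -> exists A, [/\ open A, A x & Ck k A f]) -> Ck k U f.
Proof.
elim: k f => [|k IH] f loc.
  by move=> x /loc[A [_ Ax]]; exact.
apply/CkSP; split=> [x /loc[A [_ Ax /CkSP[+ _]]]|v]; first exact.
by apply: IH => x /loc[A [oA Ax /CkSP[_ Df]]]; exists A.
Qed.

Lemma near_slice1 (T S : topologicalType) (A : set (T * S)) (x : T) (y : S) :
  (\forall p \near (x, y), A p) -> \forall z \near x, A (z, y).
Proof.
move=> [[B C] /= [Bx Cy] BCA]; apply: filterS Bx => z Bz; apply: BCA; split => //=.
exact: nbhs_singleton.
Qed.

Lemma near_slice2 (T S : topologicalType) (A : set (T * S)) (x : T) (y : S) :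
  (\forall p \near (x, y), A p) -> \forall z \near y, A (x, z).
Proof.
move=> [[B C] /= [Bx Cy] BCA]; apply: filterS Cy => z Cz; apply: BCA; split => //=.
exact: nbhs_singleton.
Qed.

(** * Derivatives along curves and symmetry of second derivatives *)

(** Difference quotients along a line only depend on the restriction to the line.
    This makes [derive_line] unconditional, so that it can be used under a second
    derivative. *)
Lemma growth_line (R : realType) (V W : normedModType R) (f : V -> W)
    (x u : V) (r : R) :
  (fun h => h^-1 *: (((fun r : R => f (x + r *: u)) \o shift r) (h *: 1) -
                     f (x + r *: u))) =
  (fun h => h^-1 *: ((f \o shift (x + r *: u)) (h *: u) - f (x + r *: u))).
Proof.
apply/funext => h /=; congr (_ *: (f _ - _)).
by rewrite [h *: 1]mulr1 scalerDl addrCA.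
Qed.

Lemma derive_line (R : realType) (V W : normedModType R) (f : V -> W)
    (x u : V) (r : R) : 'D_1 (fun r : R => f (x + r *: u)) r = 'D_u f (x + r *: u).
Proof. by rewrite /derive growth_line. Qed.

Lemma is_derive_along (R : realType) (V W : normedModType R) (f : V -> W)
    (x u : V) (r : R) : differentiable f (x + r *: u) ->
  is_derive r 1 (fun r : R => f (x + r *: u)) ('D_u f (x + r *: u)).
Proof.
move=> df; apply: DeriveDef; last exact: derive_line.
by rewrite /derivable growth_line; exact: diff_derivable.
Qed.

Lemma linear_pair (R : realType) (W : normedModType R) (L : {linear (R * R)%type -> W})
    (x y : R) : L (x, y) = x *: L (1, 0) + y *: L (0, 1).
Proof.
rewrite -!linearZ -linearD /=; congr (L _).
apply/pair_equal_spec; split.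
  by rewrite -[RHS]/(x * 1 + y * 0) mulr0 addr0 mulr1.
by rewrite -[RHS]/(x * 0 + y * 1) mulr0 add0r mulr1.
Qed.

Lemma is_derive_pair (R : realType) (W : normedModType R) (f : R * R -> W)
    (a b : R -> R) (r a' b' : R) :
  differentiable f (a r, b r) -> is_derive r 1 a a' -> is_derive r 1 b b' ->
  is_derive r 1 (fun r => f (a r, b r))
    (a' *: 'D_(1, 0) f (a r, b r) + b' *: 'D_(0, 1) f (a r, b r)).
Proof.
move=> df [/derivable1_diffP da <-] [/derivable1_diffP db <-].
have dab := differentiable_pair da db.
have dfab : differentiable (f \o fun r => (a r, b r)) r.
  exact: differentiable_comp.
apply: DeriveDef; first exact/derivable1_diffP.
rewrite -[fun r => f _]/(f \o fun r => (a r, b r)) (deriveE _ dfab).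
rewrite (diff_comp dab df) /= (diff_pair da db) /=.
rewrite (deriveE (1 : R) da) (deriveE (1 : R) db) (deriveE ((1, 0) : (R * R)%type) df)
  (deriveE ((0, 1) : (R * R)%type) df).
exact: linear_pair.
Qed.

(** The mean value theorem applied first in the direction [u], then in the
    direction [v].  The second difference on the left is symmetric in [u] and
    [v], the expression on the right is not. *)
Lemma double_difference (R : realType) (V : normedModType R) (U : set V)
    (f : V -> R) (p u v : V) (h : R) : 0 < h -> Ck 2 U f ->
  (forall x y, 0 <= x <= h -> 0 <= y <= h -> U (p + x *: u + y *: v)) ->
  exists x y, [/\ 0 <= x <= h, 0 <= y <= h &
    f (p + h *: u + h *: v) - f (p + h *: u) - f (p + h *: v) + f p =
    'D_v ('D_u f) (p + x *: u + y *: v) * h * h].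
Proof.
move=> h0 /CkSP[df Df] pU; have /CkSP[ddf _] := Df u.
have h00 : 0 <= (0 : R) <= h by rewrite lexx ltW.
have hh : 0 <= h <= h by rewrite lexx ltW.
have U0 x : 0 <= x <= h -> U (p + x *: u).
  by move=> xh; have := pU x 0 xh h00; rewrite scale0r addr0.
have swap x : p + x *: u + h *: v = p + h *: v + x *: u by rewrite addrAC.
pose g x := f (p + x *: u + h *: v) - f (p + x *: u).
have dg x : 0 <= x <= h ->
    is_derive x 1 g ('D_u f (p + x *: u + h *: v) - 'D_u f (p + x *: u)).
  move=> xh; apply: is_deriveB; last exact/is_derive_along/df/U0.
  rewrite swap (_ : (fun x => _) = (fun x => f (p + h *: v + x *: u))).
    by apply: is_derive_along; rewrite -swap; exact/df/pU.
  by apply/funext => z; rewrite swap.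
have [||x xh gE] := @MVT_segment R g
    (fun x => 'D_u f (p + x *: u + h *: v) - 'D_u f (p + x *: u)) 0 h (ltW h0).
- by move=> x; rewrite in_itv /= => /andP[x0 xh]; apply: dg; rewrite !ltW.
- apply: derivable_within_continuous => x; rewrite in_itv /= => xh.
  by have [] := dg x xh.
rewrite in_itv /= in xh.
pose k y := 'D_u f (p + x *: u + y *: v).
have dk y : 0 <= y <= h -> is_derive y 1 k ('D_v ('D_u f) (p + x *: u + y *: v)).
  by move=> yh; exact/is_derive_along/ddf/pU.
have [||y yh kE] := @MVT_segment R k
    (fun y => 'D_v ('D_u f) (p + x *: u + y *: v)) 0 h (ltW h0).
- by move=> y; rewrite in_itv /= => /andP[y0 yh]; apply: dk; rewrite !ltW.
- apply: derivable_within_continuous => y; rewrite in_itv /= => yh.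
  by have [] := dk y yh.
rewrite in_itv /= in yh.
exists x, y; split => //.
move: kE gE; rewrite /k /g !scale0r !addr0 !subr0 => <- <-.
by rewrite opprB addrA addrAC -!addrA; congr (_ + _); rewrite addrC -addrA.
Qed.

(** Both mixed derivatives are, by [double_difference], values of the same second
    difference quotient at points close to [p]; their continuity concludes. *)
Lemma deriveC (R : realType) (V : normedModType R) (U : set V) (f : V -> R)
    (p u v : V) : open U -> U p -> Ck 2 U f ->
  'D_u ('D_v f) p = 'D_v ('D_u f) p.
Proof.
move=> oU Up cf; apply/eqP; rewrite -subr_eq0 -normr_le0.
apply/ler_addgt0Pl => e e0; rewrite addr0.
have cont w1 w2 : {for p, continuous ('D_w1 ('D_w2 f))}.
  have /CkSP[_ /(_ w2)/CkSP[_ /(_ w1)]] := cf; exact.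
have e20 : 0 < e / 2 by rewrite divr_gt0.
pose m (z : R * R) := p + z.1 *: u + z.2 *: v.
have m0 : m (0, 0) = p by rewrite /m /= !scale0r !addr0.
have cm : m z @[z --> (0, 0)] --> p.
  rewrite -[X in _ --> X]m0; apply: cvgD; last by apply: cvgZr_tmp; exact: cvg_snd.
  by apply: cvgD; [exact: cvg_cst|apply: cvgZr_tmp; exact: cvg_fst].
have /nbhs_ballP[d /= d0 dm] : \forall z \near ((0, 0) : R * R), [/\ U (m z),
    `|'D_u ('D_v f) p - 'D_u ('D_v f) (m z)| < e / 2 &
    `|'D_v ('D_u f) p - 'D_v ('D_u f) (m z)| < e / 2].
  have N1 : \forall z \near ((0, 0) : R * R), U (m z).
    by apply: cm; exact: open_nbhs_nbhs.
  have N2 w1 w2 : \forall z \near ((0, 0) : R * R),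
      `|'D_w1 ('D_w2 f) p - 'D_w1 ('D_w2 f) (m z)| < e / 2.
    by have /cvgrPdist_lt := cvg_comp _ _ cm (cont w1 w2); exact.
  by apply: filterS3 N1 (N2 u v) (N2 v u) => z; split.
have inb x y : 0 <= x <= d / 2 -> 0 <= y <= d / 2 ->
    ball ((0, 0) : R * R) d (x, y).
  move=> /andP[x0 xd] /andP[y0 yd].
  have dd : d / 2 < d by rewrite ltr_pdivrMr // ltr_pMr // ltr1n.
  split; rewrite -ball_normE /= sub0r normrN ger0_norm //.
    exact: le_lt_trans xd dd.
  exact: le_lt_trans yd dd.
have d20 : 0 < d / 2 by rewrite divr_gt0.
have [|x1 [y1 [x1d y1d E1]]] := @double_difference R V U f p u v _ d20 cf.
  by move=> x y xd yd; have [] := dm _ (inb x y xd yd).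
have [|x2 [y2 [x2d y2d E2]]] := @double_difference R V U f p v u _ d20 cf.
  move=> x y xd yd; have [] := dm _ (inb y x yd xd).
  by rewrite /m /= addrAC.
have cancel S1 S2 A B : S1 = A * (d / 2) * (d / 2) ->
    S2 = B * (d / 2) * (d / 2) -> S1 = S2 -> A = B.
  have d2n0 : d / 2 != 0 by rewrite gt_eqF.
  by move=> -> -> /(mulIf d2n0)/(mulIf d2n0).
have E := cancel _ _ _ _ E1 E2; rewrite (addrAC p (x2 *: v)) in E.
have {}E : 'D_v ('D_u f) (m (x1, y1)) = 'D_u ('D_v f) (m (y2, x2)).
  apply: E; rewrite (addrAC p (_ *: v)); congr (_ + _).
  exact: addrAC.
have [_ _ h1] := dm _ (inb _ _ x1d y1d); have [_ h2 _] := dm _ (inb _ _ y2d x2d).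
have tri (A B X Y : R) :
    `|X - A| < e / 2 -> `|Y - B| < e / 2 -> B = A -> `|X - Y| <= e.
  move=> XA + BA; rewrite BA distrC => YA.
  apply: le_trans (ler_distD A X Y) _; rewrite (splitr e).
  exact: lerD (ltW XA) (ltW YA).
exact: tri h2 h1 E.
Qed.

(** * Partial derivatives and the function phi - s phi_2 *)

Section PartialDerivatives.
Variables (R : realType) (phi : R -> R -> R) (O : set (R * R)).
Hypotheses (O_open : open O) (phi_smooth : smooth_on O (fun p => phi p.1 p.2)).

Lemma d1E (f : R -> R -> R) t s :
  d1 f t s = 'D_(1, 0) (fun p : R * R => f p.1 p.2) (t, s).
Proof.
rewrite /d1 derive1E.
exact: (derive_slice1 (fun p : R * R => f p.1 p.2) t (1 : R) s).
Qed.

Lemma d2E (f : R -> R -> R) t s :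
  d2 f t s = 'D_(0, 1) (fun p : R * R => f p.1 p.2) (t, s).
Proof.
rewrite /d2 derive1E.
exact: (derive_slice2 (fun p : R * R => f p.1 p.2) t s (1 : R)).
Qed.

Lemma uncurry_d1 (f : R -> R -> R) :
  (fun p : R * R => d1 f p.1 p.2) = 'D_(1, 0) (fun p : R * R => f p.1 p.2).
Proof. by apply/funext => -[t s]; exact: d1E. Qed.

Lemma uncurry_d2 (f : R -> R -> R) :
  (fun p : R * R => d2 f p.1 p.2) = 'D_(0, 1) (fun p : R * R => f p.1 p.2).
Proof. by apply/funext => -[t s]; exact: d2E. Qed.

Lemma smooth_d1 : smooth_on O (fun p => d1 phi p.1 p.2).
Proof. by move=> k; rewrite uncurry_d1; have /CkSP[_] := phi_smooth k.+1. Qed.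

Lemma smooth_d2 : smooth_on O (fun p => d2 phi p.1 p.2).
Proof. by move=> k; rewrite uncurry_d2; have /CkSP[_] := phi_smooth k.+1. Qed.

Lemma d1_d2 t s : O (t, s) -> d1 (d2 phi) t s = d2 (d1 phi) t s.
Proof.
move=> Ots; rewrite d1E d2E uncurry_d1 uncurry_d2.
exact: deriveC O_open Ots (phi_smooth 2).
Qed.

Lemma is_derive_curve (a b : R -> R) (r a' b' : R) :
  O (a r, b r) -> is_derive r 1 a a' -> is_derive r 1 b b' ->
  is_derive r 1 (fun r => phi (a r) (b r))
    (a' * d1 phi (a r) (b r) + b' * d2 phi (a r) (b r)).
Proof.
move=> Oab da db; rewrite d1E d2E.
apply: (is_derive_pair (f := fun p : R * R => phi p.1 p.2)) => //.
by have /CkSP[+ _] := phi_smooth 1; exact.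
Qed.

Lemma is_derive_d2 t s : O (t, s) -> is_derive s 1 (phi t) (d2 phi t s).
Proof.
move=> Ots; have := is_derive_curve (a := cst t) (b := id) Ots
  (is_derive_cst _ _ _) (is_derive_id _ _).
by rewrite mul0r add0r mul1r.
Qed.

Lemma smooth_slice t : smooth_on [set s | O (t, s)] (phi t).
Proof. by move=> k; exact: (Ck_slice t (phi_smooth k)). Qed.

Lemma continuous_slice t s : O (t, s) -> {for s, continuous (phi t)}.
Proof. by move=> Ots; have := smooth_slice t 0%N; exact. Qed.

End PartialDerivatives.

Definition legendre (R : realType) (phi : R -> R -> R) (t s : R) : R :=
  phi t s - s * d2 phi t s.

(** The mixed derivative appears as [d1 (d2 phi)] when one differentiates, and as
    [d2 (d1 phi)] in the PDE. *)
Lemma is_derive_legendre (R : realType) (phi : R -> R -> R) (O : set (R * R))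
    (b : R -> R) (t b' : R) : open O -> smooth_on O (fun p => phi p.1 p.2) ->
  O (t, b t) -> is_derive t 1 b b' ->
  is_derive t 1 (fun t => legendre phi t (b t))
    (d1 phi t (b t) - b t * d2 (d1 phi) t (b t)
     - b t * b' * d2 (d2 phi) t (b t)).
Proof.
move=> oO sphi Otb db.
have dphi := is_derive_curve sphi Otb (is_derive_id t 1) db.
have dphi2 := is_derive_curve (smooth_d2 sphi) Otb (is_derive_id t 1) db.
apply: is_derive_eq (is_deriveB dphi (is_deriveM db dphi2)) _.
rewrite -(d1_d2 oO sphi Otb) /GRing.scale /=; ring.
Qed.

Lemma is_derive_legendre2 (R : realType) (phi : R -> R -> R) (O : set (R * R))
    (t s : R) : smooth_on O (fun p => phi p.1 p.2) -> O (t, s) ->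
  is_derive s 1 (legendre phi t) (- s * d2 (d2 phi) t s).
Proof.
move=> sphi Ots.
have dphi := is_derive_d2 sphi Ots.
have dphi2 := is_derive_d2 (smooth_d2 sphi) Ots.
apply: is_derive_eq (is_deriveB dphi (is_deriveM (is_derive_id s 1) dphi2)) _.
rewrite /GRing.scale /=; ring.
Qed.

(** * Level curves of zeta *)

Lemma is_derive_continuous (R : realType) (f : R -> R) (x d : R) :
  is_derive x 1 f d -> {for x, continuous f}.
Proof. by move=> [/derivable1_diffP/differentiable_continuous]. Qed.

Section Characteristics.
Variables (R : realType) (I : set R) (P K : R -> R).
Implicit Types (t s z e : R).

(** The value of b^2 - s^2 at the parameter [t] on the level [z] of zeta: the
    equation w / (e^P + w K) = z solved for w. *)
Definition level_w z t : R := z * expR (P t) / (1 - z * K t).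

(** The sign [e] selects one of the two branches of the level curve. *)
Definition level_s e z t : R := e * Num.sqrt (t - level_w z t).

Lemma pde_domE t s : pde_dom I (t, s) <-> [/\ I t, 0 < t & s ^+ 2 < t].
Proof.
rewrite /pde_dom /pos_part /=; split=> [[[It t0]]|[It t0]].
  by rewrite -sqrtr_sqr ltr_sqrt.
by rewrite -sqrtr_sqr ltr_sqrt.
Qed.

Lemma formula_domE t s : formula_dom I P K (t, s) <->
  [/\ pos_part I t, 0 < t - s ^+ 2, s != 0 & zeta_den P K t s != 0].
Proof.
rewrite /formula_dom /= subr_gt0; split=> [[/pde_domE[It t0 st]]|[[It t0] st]].
  by [].
by split => //; exact/pde_domE.
Qed.

Lemma zeta_coef t s : zeta_den P K t s != 0 ->
  1 - zeta P K t s * K t = expR (P t) / zeta_den P K t s.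
Proof. by rewrite /zeta /zeta_den => d0; field. Qed.

Lemma zeta_coef_neq0 t s :
  zeta_den P K t s != 0 -> 1 - zeta P K t s * K t != 0.
Proof.
by move=> d0; rewrite zeta_coef // mulf_neq0 ?invr_neq0 // gt_eqF // expR_gt0.
Qed.

Lemma level_w_zeta t s : zeta_den P K t s != 0 ->
  level_w (zeta P K t s) t = t - s ^+ 2.
Proof.
move=> d0; rewrite /level_w zeta_coef // /zeta.
by field; rewrite d0 gt_eqF // expR_gt0.
Qed.

Lemma level_s_sqr e z t : e ^+ 2 = 1 -> level_w z t < t ->
  t - level_s e z t ^+ 2 = level_w z t.
Proof.
move=> e1 wt; rewrite /level_s exprMn e1 sqr_sqrtr ?subr_ge0 ?(ltW wt) //.
by rewrite mul1r opprB addrCA subrr addr0.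
Qed.

Lemma level_s_zeta t s : zeta_den P K t s != 0 ->
  level_s (Num.sg s) (zeta P K t s) t = s.
Proof.
move=> d0; rewrite /level_s level_w_zeta // opprB addrCA subrr addr0.
by rewrite sqrtr_sqr mulr_sg_norm.
Qed.

Lemma zeta_level_s e z t : e ^+ 2 = 1 -> level_w z t < t ->
  1 - z * K t != 0 -> zeta P K t (level_s e z t) = z.
Proof.
move=> e1 wt zK; rewrite /zeta /zeta_den level_s_sqr // /level_w.
have eP := expR_gt0 (P t).
have -> : expR (P t) + z * expR (P t) / (1 - z * K t) * K t =
    expR (P t) / (1 - z * K t) by field.
by field; rewrite zK gt_eqF.
Qed.

End Characteristics.

Section NearCurve.
Variables (R : realType) (I : set R) (P K : R -> R).
Hypothesis I_open : open I.
Hypotheses (P_cont : forall t, pos_part I t -> {for t, continuous P})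
           (K_cont : forall t, pos_part I t -> {for t, continuous K}).

Lemma continuous_level_w (q : R * R) : pos_part I q.1 -> 1 - q.2 * K q.1 != 0 ->
  {for q, continuous (fun q : R * R => level_w P K q.2 q.1)}.
Proof.
move=> It zK.
have cP : P z.1 @[z --> q] --> P q.1.
  by apply: (continuous_comp _ (P_cont It)); exact: cvg_fst.
have cK : K z.1 @[z --> q] --> K q.1.
  by apply: (continuous_comp _ (K_cont It)); exact: cvg_fst.
have c2 : z.2 @[z --> q] --> q.2 by exact: cvg_snd.
rewrite /prop_for /continuous_at /level_w; apply: cvgM.
  apply: cvgM => //; apply: continuous_cvg cP; exact: continuous_expR.
apply: cvgV => //; apply: cvgB; [exact: cvg_cst|exact: cvgM].
Qed.

Lemma continuous_level_s e (q : R * R) : pos_part I q.1 ->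
  1 - q.2 * K q.1 != 0 ->
  {for q, continuous (fun q : R * R => level_s P K e q.2 q.1)}.
Proof.
move=> It zK; rewrite /prop_for /continuous_at /level_s.
apply: cvgM; first exact: cvg_cst.
apply: (@continuous_cvg _ _ _ _ _ _ Num.sqrt); first exact: sqrt_continuous.
apply: cvgB; first exact: cvg_fst.
exact: continuous_level_w.
Qed.

Lemma continuous_zeta_den (p : R * R) : pos_part I p.1 ->
  {for p, continuous (fun p : R * R => zeta_den P K p.1 p.2)}.
Proof.
move=> It.
have cP : P z.1 @[z --> p] --> P p.1.
  by apply: (continuous_comp _ (P_cont It)); exact: cvg_fst.
have cK : K z.1 @[z --> p] --> K p.1.
  by apply: (continuous_comp _ (K_cont It)); exact: cvg_fst.
rewrite /prop_for /continuous_at /zeta_den; apply: cvgD.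
  apply: continuous_cvg cP; exact: continuous_expR.
apply: cvgM => //; apply: cvgB; first exact: cvg_fst.
by apply: cvgM; exact: cvg_snd.
Qed.

Lemma pos_part_open : open (pos_part I).
Proof. by apply: openI => //; exact: open_gt. Qed.

Lemma formula_dom_open : open (formula_dom I P K).
Proof.
rewrite openE => -[t s] /formula_domE[It w0 s0 d0].
have c1 : z.1 @[z --> (t, s)] --> t by exact: cvg_fst.
have c2 : z.2 @[z --> (t, s)] --> s by exact: cvg_snd.
have N1 : \forall z \near (t, s), pos_part I z.1.
  by apply: c1; apply: open_nbhs_nbhs; split => //; exact: pos_part_open.
have N2 : \forall z \near (t, s), 0 < z.1 - z.2 ^+ 2.
  have cw : z.1 - z.2 ^+ 2 @[z --> (t, s)] --> t - s ^+ 2.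
    by apply: cvgB => //; rewrite expr2; under eq_fun do rewrite expr2; exact: cvgM.
  exact: (cvgr_gt _ cw).
have N3 : \forall z \near (t, s), z.2 != 0 by exact: (cvgr_neq0 _ c2).
have N4 : \forall z \near (t, s), zeta_den P K z.1 z.2 != 0.
  have := continuous_zeta_den (p := (t, s)) It.
  by move=> /cvgr_neq0; apply.
by near do (apply/formula_domE; split).
Unshelve. all: by end_near. Qed.

(** (t, z) are local coordinates near a point with s <> 0: the box around
    (t, zeta) is mapped by the branch of the same sign into any neighbourhood. *)
Lemma near_level_curve (U : set (R * R)) t s : open U ->
  U `<=` formula_dom I P K -> U (t, s) ->
  \forall q \near (t, zeta P K t s),
    [/\ U (q.1, level_s P K (Num.sg s) q.2 q.1), 1 - q.2 * K q.1 != 0 &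
        0 < level_w P K q.2 q.1 < q.1].
Proof.
move=> oU UF Uts; have /formula_domE[It w0 s0 d0] := UF _ Uts.
set q0 := (t, _).
have c1 : z.1 @[z --> q0] --> t by exact: cvg_fst.
have c2 : z.2 @[z --> q0] --> q0.2 by exact: cvg_snd.
have zK : 1 - q0.2 * K q0.1 != 0 by exact: zeta_coef_neq0.
have cw := @continuous_level_w q0 It zK.
have cs := @continuous_level_s (Num.sg s) q0 It zK.
have N1 : \forall q \near q0, 0 < level_w P K q.2 q.1.
  by apply: (cvgr_gt _ cw); rewrite /= level_w_zeta.
have N2 : \forall q \near q0, 0 < q.1 - level_w P K q.2 q.1.
  apply: (cvgr_gt _ (cvgB c1 cw)) => /=.
  by rewrite level_w_zeta // opprB addrCA subrr addr0 exprn_even_gt0.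
have N3 : \forall q \near q0, 1 - q.2 * K q.1 != 0.
  have cK : K z.1 @[z --> q0] --> K t.
    by apply: (continuous_comp _ (K_cont It)); exact: cvg_fst.
  have c3 : 1 - z.2 * K z.1 @[z --> q0] --> 1 - q0.2 * K t.
    by apply: cvgB; [exact: cvg_cst|exact: cvgM].
  exact: (cvgr_neq0 _ c3).
have N4 : \forall q \near q0, U (q.1, level_s P K (Num.sg s) q.2 q.1).
  have c : (q.1, level_s P K (Num.sg s) q.2 q.1) @[q --> q0] --> (t, s).
    by rewrite -[X in _ --> (_, X)](level_s_zeta d0); exact: cvg_pair c1 cs.
  by apply: c; exact: open_nbhs_nbhs.
near=> q; split; [by near: q|by near: q|].
by apply/andP; split; [near: q|rewrite -subr_gt0; near: q].
Unshelve. all: by end_near. Qed.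

End NearCurve.

(** * Transport along the level curves *)

Section Transport.
Variables (R : realType) (I : set R) (c mu nu P K Q : R -> R).
Hypothesis PKQ : integrals I c mu nu P K Q.
Variables (phi : R -> R -> R) (O : set (R * R)).
Hypotheses (O_open : open O) (phi_smooth : smooth_on O (fun p => phi p.1 p.2)).
Implicit Types (t s z e : R).

Definition pde_lhs t s : R :=
  let b := Num.sqrt t in
  let A := (nu t - mu t) * s ^+ 2 - nu t * b ^+ 2 in
  (b ^+ 3 * ((1 - c t) * s ^+ 2 + c t * b ^+ 2) + A * (b ^+ 2 - s ^+ 2))
    * d2 (d2 phi) t s.

Definition pde_rhs t s : R :=
  let b := Num.sqrt t in
  let A := (nu t - mu t) * s ^+ 2 - nu t * b ^+ 2 in
  2 * b ^+ 5 * (d1 phi t s - s * d2 (d1 phi) t s)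
    - A * (phi t s - s * d2 phi t s).

(** The factor sqrt(b^2 - s^2) / xi removes the term of order zero from the
    transport equation satisfied by phi - s phi_2. *)
Definition reduced t s : R := legendre phi t s * Num.sqrt (t - s ^+ 2) / xi Q t.

Lemma is_derive_level_w z t : pos_part I t -> 1 - z * K t != 0 ->
  is_derive t 1 (level_w P K z)
    (level_w P K z t * (((1 - c t) * Num.sqrt t + mu t) / Num.sqrt t ^+ 3
     + level_w P K z t * (nu t - mu t) / Num.sqrt t ^+ 5)).
Proof.
move=> It zK; have [/(_ t It) dP /(_ t It) dK _] := PKQ.
have dE := is_derive1_comp (is_derive_expR (P t)) dP.
have dD := is_deriveB (is_derive_cst (1 : R) t 1) (is_deriveM (is_derive_cst z t 1) dK).
have dV := is_deriveV (f := fun t => 1 - z * K t) zK dD.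
apply: is_derive_eq (is_deriveM (is_deriveM (is_derive_cst z t 1) dE) dV) _.
rewrite /GRing.scale /= /level_w.
rewrite -[X in X * (- _ * _)]/(z * expR (P t)).
have b0 : Num.sqrt t != 0 by rewrite gt_eqF // sqrtr_gt0; case: It.
move: (Num.sqrt t) b0 => b b0; by field; rewrite zK b0.
Qed.

(** Here [b], [r] stand for sqrt t and sqrt(b^2 - s^2), [w'] is the derivative of
    [level_w] and (1 - w') / (2 s) the slope of the level curve; [psit], [phi22]
    stand for phi_1 - s phi_12 and phi_22.  The left-hand side is the Leibniz
    rule for psi * r / x. *)
Lemma transport_identity (k b s r m n x psi psit phi22 : R) :
  b != 0 -> s != 0 -> r != 0 -> x != 0 -> s ^+ 2 = b ^+ 2 - r ^+ 2 ->
  let w' := r ^+ 2 * (((1 - k) * b + m) / b ^+ 3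
            + r ^+ 2 * (n - m) / b ^+ 5) in
  let A := (n - m) * s ^+ 2 - n * b ^+ 2 in
  (psit - s * ((1 - w') / (2 * s)) * phi22) * r * x^-1 +
  psi * (w' / (2 * r)) * x^-1 - psi * r * ((1 - k) / (2 * b ^+ 2)) * x^-1 =
  r / (2 * b ^+ 5 * x) * (2 * b ^+ 5 * psit - A * psi -
    (b ^+ 3 * ((1 - k) * s ^+ 2 + k * b ^+ 2) + A * (b ^+ 2 - s ^+ 2)) * phi22).
Proof.
move=> b0 s0 r0 x0 sE w' A; rewrite /w' /A sE.
field.
by rewrite b0 s0 r0 x0.
Qed.

(** The level curves are the characteristics of the PDE: only the combination of
    derivatives that occurs in the PDE survives. *)
Lemma is_derive_reduced e z t : e ^+ 2 = 1 -> pos_part I t ->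
  1 - z * K t != 0 -> 0 < level_w P K z t < t -> O (t, level_s P K e z t) ->
  let s := level_s P K e z t in
  is_derive t 1 (fun t => reduced t (level_s P K e z t))
    (Num.sqrt (t - s ^+ 2) / (2 * Num.sqrt t ^+ 5 * xi Q t) *
     (pde_rhs t s - pde_lhs t s)).
Proof.
move=> e1 It zK /andP[w0 wt] Ots s.
have dw := is_derive_level_w It zK; set w' := _ * _ in dw.
have [_ _ /(_ t It) dQ] := PKQ.
have e0 : e != 0 by apply/eqP => e0; move/eqP: e1; rewrite e0 expr0n /= eq_sym oner_eq0.
have tw0 : 0 < t - level_w P K z t by rewrite subr_gt0.
have s0 : s != 0 by rewrite mulf_neq0 // gt_eqF // sqrtr_gt0.
have ds : is_derive t 1 (level_s P K e z) ((1 - w') / (2 * s)).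
  have dr := is_derive1_comp (f := Num.sqrt) (g := fun t => t - level_w P K z t)
    (is_derive1_sqrt tw0) (is_deriveB (is_derive_id t 1) dw).
  apply: is_derive_eq (is_deriveM (is_derive_cst e t 1) dr) _.
  rewrite /GRing.scale /= /cst mulr0 addr0 /s /level_s.
  have : Num.sqrt (t - level_w P K z t) != 0 by rewrite gt_eqF // sqrtr_gt0.
  move: (Num.sqrt _) => q q0.
  have eV : e^-1 = e by apply: (mulfI e0); rewrite mulfV // -expr2 e1.
  by rewrite !invfM eV; field.
have dl := is_derive_legendre O_open phi_smooth Ots ds.
have dsw := is_derive1_comp (is_derive1_sqrt w0) dw.
have dx := is_derive1_comp (f := expR) (g := - Q) (is_derive_expR _) (is_deriveN dQ).
have D := is_deriveM (is_deriveM dl dsw) dx.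
have near_w : \near t, level_w P K z t < t.
  have cw : {for t, continuous (fun t => t - level_w P K z t)}.
    exact: is_derive_continuous (is_deriveB (is_derive_id t 1) dw).
  have H : \forall y \near t, 0 < y - level_w P K z y.
    exact: (cvgr_gt _ cw).
  by apply: filterS H => y; rewrite subr_gt0.
have N : \near t, ((fun t => legendre phi t (level_s P K e z t)) *
    (Num.sqrt \o level_w P K z) * (expR \o - Q)) t =
    reduced t (level_s P K e z t).
  apply: filterS near_w => y wy.
  rewrite /reduced level_s_sqr // /xi -expRN.
  by [].
apply: near_eq_is_derive N _; apply: is_derive_eq D _.
rewrite level_s_sqr // -/s.
have b0 : Num.sqrt t != 0 by rewrite gt_eqF // sqrtr_gt0; case: It.
have r0 : Num.sqrt (level_w P K z t) != 0 by rewrite gt_eqF // sqrtr_gt0.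
have tb : t = Num.sqrt t ^+ 2 by rewrite sqr_sqrtr //; case: It => _ /ltW.
have wr : level_w P K z t = Num.sqrt (level_w P K z t) ^+ 2.
  by rewrite sqr_sqrtr // ltW.
have sE : s ^+ 2 = Num.sqrt t ^+ 2 - Num.sqrt (level_w P K z t) ^+ 2.
  by rewrite -tb -wr -(level_s_sqr e1 wt) -/s opprB addrCA subrr addr0.
have x0 : xi Q t != 0 by rewrite gt_eqF // expR_gt0.
have alg := transport_identity (c t) (mu t) (nu t) (legendre phi t s)
  (d1 phi t s - s * d2 (d1 phi) t s) (d2 (d2 phi) t s) b0 s0 r0 x0 sE.
move: alg; rewrite -wr -/w' -tb /= => alg.
rewrite /pde_rhs /pde_lhs -tb -[X in _ = _ * (_ - _ * X - _)]/(legendre phi t s).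
rewrite -alg /GRing.scale /= -[(_ * _) t]/(legendre phi t s * Num.sqrt _).
rewrite -/(xi Q t) expRN -/(xi Q t) invfM; clearbody w' s.
move: (Num.sqrt (level_w P K z t)) (xi Q t)^-1 (legendre phi t s) (d1 phi t s)
  (d2 (d1 phi) t s) (d2 (d2 phi) t s) => r x l p1 p12 p22.
by ring.
Qed.

End Transport.

(** * Functions with vanishing derivative *)

Lemma cst_on_derive0 (R : realType) (f : R -> R) (x y : R) : x <= y ->
  (forall z, x <= z <= y -> is_derive z 1 f 0) -> f x = f y.
Proof.
move=> xy df.
have [z zi||z _ E] := @MVT_segment R f (fun=> 0) x y xy.
- by apply: df; move: zi; rewrite in_itv /= => /andP[/ltW -> /ltW ->].
- by apply: derivable_within_continuous => z; rewrite in_itv => /df[].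
- by apply/esym/eqP; rewrite -subr_eq0 E mul0r.
Qed.

Lemma cst_ball_derive0 (R : realType) (f : R -> R) (x r : R) :
  (forall y, `|x - y| < r -> is_derive y 1 f 0) ->
  forall y, `|x - y| < r -> f y = f x.
Proof.
move=> df y xyr; have [xy|/ltW yx] := leP x y.
  apply/esym/(cst_on_derive0 xy) => z /andP[xz zy]; apply: df.
  apply: le_lt_trans xyr; rewrite distrC (distrC x) !ger0_norm ?subr_ge0 //.
  by rewrite lerB.
apply/(cst_on_derive0 yx) => z /andP[yz zx]; apply: df.
apply: le_lt_trans xyr; rewrite !ger0_norm ?subr_ge0 //.
by rewrite lerB.
Qed.

(** The points of [A] where [f] takes the value [f p] are cut out by an open set,
    and so are the other points. *)
Lemma locally_cst_connected (T : topologicalType) (S : Type) (A : set T)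
    (f : T -> S) : connected A ->
  (forall p, A p -> \forall q \near p, A q -> f q = f p) ->
  forall p q, A p -> A q -> f q = f p.
Proof.
move=> cA lf p q Ap Aq.
pose E1 : set T := [set q | A q -> f q = f p].
pose E2 : set T := [set q | A q -> f q <> f p].
have AE : A `&` E1^° = A `&` ~` E2^°.
  apply/seteqP; split=> x [Ax Ex]; split => //.
    by move=> /nbhs_singleton /(_ Ax); apply; exact: (nbhs_singleton Ex Ax).
  have [fx|nfx] := pselect (f x = f p).
    by apply: filterS (lf x Ax) => y xy /xy ->.
  by exfalso; apply: Ex; apply: filterS (lf x Ax) => y xy /xy ->.
have : A `&` E1^° = A.
  apply: cA; [exists p|exists (E1^°)|exists (~` E2^°)] => //.
  - by split => //; apply: filterS (lf p Ap).
  - exact: open_interior.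
  - by apply: open_closedC; exact: open_interior.
by move=> AE1; have : A q by []; rewrite -AE1 => -[_ /nbhs_singleton]; exact.
Qed.

(** * Solutions of the PDE *)

Section GeneralSolution.
Variables (R : realType) (I : set R) (c mu nu P K Q : R -> R).
Hypothesis I_open : open I.
Hypothesis PKQ : integrals I c mu nu P K Q.
Variables (phi : R -> R -> R) (O : set (R * R)).
Hypotheses (O_open : open O) (phi_smooth : smooth_on O (fun p => phi p.1 p.2)).
Hypothesis pde_dom_O : pde_dom I `<=` O.
Implicit Types (t s z e : R) (U : set (R * R)).

Let P_cont t : pos_part I t -> {for t, continuous P}.
Proof. by have [dP _ _] := PKQ => /dP; exact: is_derive_continuous. Qed.

Let K_cont t : pos_part I t -> {for t, continuous K}.
Proof. by have [_ dK _] := PKQ => /dK; exact: is_derive_continuous. Qed.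

Lemma formula_dom_O : formula_dom I P K `<=` O.
Proof. by move=> p [pI _ _]; exact: pde_dom_O. Qed.

Lemma sqr_sg_neq0 s : s != 0 -> Num.sg s ^+ 2 = 1.
Proof. by rewrite sqr_sg => ->. Qed.

(** Differentiating s (h - xi G) gives phi - s phi_2 = s^2 xi G_s: the terms with
    [h] and [G] cancel. *)
Lemma reduced_formula U h Phi G t s : open U -> U `<=` formula_dom I P K ->
  formula_on U P K Q phi h Phi G -> U (t, s) ->
  reduced Q phi t s = Phi (zeta P K t s).
Proof.
move=> oU UF [_ _ dG phiE] Uts; have /formula_domE[_ w0 s0 _] := UF _ Uts.
have N : \forall y \near s, y * (h t - xi Q t * G t y) = phi t y.
  have : \forall y \near s, U (t, y).
    by apply: near_slice2; exact: open_nbhs_nbhs.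
  by apply: filterS => y /phiE ->.
have D := is_deriveM (is_derive_id s 1) (is_deriveB (is_derive_cst (h t) s 1)
  (is_deriveM (is_derive_cst (xi Q t) s 1) (dG _ _ Uts))).
have := near_eq_is_derive N D; rewrite /GRing.scale /= => -[_ E].
rewrite /reduced /legendre /d2 derive1E E (phiE _ _ Uts).
rewrite -[(_ - _) s]/(h t - xi Q t * G t s).
have r0 : Num.sqrt (t - s ^+ 2) != 0 by rewrite gt_eqF // sqrtr_gt0.
have x0 : xi Q t != 0 by rewrite gt_eqF // expR_gt0.
rewrite /cst; move: (Num.sqrt _) r0 => r r0.
by field; rewrite r0 x0 s0.
Qed.

(** [reduced] equals Phi(zeta), which is constant along the level curve through
    the point, so the derivative found in [is_derive_reduced] vanishes. *)
Lemma pde_of_formula U : open U -> U `<=` formula_dom I P K ->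
  has_formula U P K Q phi -> pde_on U c mu nu phi.
Proof.
move=> oU UF [h [Phi [G fU]]] t s Uts.
have /formula_domE[It w0 s0 d0] := UF _ Uts.
have e1 := sqr_sg_neq0 s0.
have near_q := near_level_curve P_cont K_cont oU UF Uts.
have [/=_ zK wt] := nbhs_singleton near_q.
set z := zeta P K t s in near_q zK wt.
have sE : level_s P K (Num.sg s) z t = s by exact: level_s_zeta.
have D := is_derive_reduced PKQ O_open phi_smooth e1 It zK wt.
rewrite sE in D; have {}D := D (formula_dom_O (UF _ Uts)).
have N : \forall y \near t, cst (Phi z) y =
    reduced Q phi y (level_s P K (Num.sg s) z y).
  apply: filterS (near_slice1 near_q) => y [Uy zKy /andP[_ wy]].
  by rewrite (reduced_formula oU UF fU Uy) zeta_level_s.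
have [_ D0] := near_eq_is_derive N (is_derive_cst (Phi z) t 1).
have b0 : 0 < Num.sqrt t by rewrite sqrtr_gt0; case: It.
have k0 : 0 < Num.sqrt (t - s ^+ 2) / (2 * Num.sqrt t ^+ 5 * xi Q t).
  by rewrite divr_gt0 ?sqrtr_gt0 // mulr_gt0 ?expR_gt0 // mulr_gt0 ?exprn_gt0.
have [_] := D; rewrite D0 => /esym/eqP.
by rewrite mulf_eq0 gt_eqF //= subr_eq0 => /eqP/esym.
Qed.

Lemma reduced_curve_cst U e z x r : U `<=` formula_dom I P K ->
  pde_on U c mu nu phi -> e ^+ 2 = 1 ->
  (forall t, `|x - t| < r -> [/\ U (t, level_s P K e z t), 1 - z * K t != 0 &
     0 < level_w P K z t < t]) ->
  forall t, `|x - t| < r -> reduced Q phi t (level_s P K e z t) =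
                           reduced Q phi x (level_s P K e z x).
Proof.
move=> UF pdeU e1 cU.
apply: (cst_ball_derive0 (f := fun t => reduced Q phi t (level_s P K e z t))).
move=> t /cU[Ut zK wt]; have /formula_domE[It _ _ _] := UF _ Ut.
apply: is_derive_eq
  (is_derive_reduced PKQ O_open phi_smooth e1 It zK wt (formula_dom_O (UF _ Ut))) _.
have E : pde_lhs c mu nu phi t (level_s P K e z t) =
  pde_rhs mu nu phi t (level_s P K e z t) := pdeU _ _ Ut.
by rewrite -E subrr mulr0.
Qed.

(** The antiderivative G absorbs the free function: one can take h = 0 and
    G = - phi / (s xi).  Near a level z, Phi is the restriction of [reduced] to a
    line of constant t, parametrized by zeta through [level_s]. *)
Lemma has_formula_of_level_cst U : open U -> U `<=` formula_dom I P K ->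
  (forall t s t' s', U (t, s) -> U (t', s') ->
     zeta P K t s = zeta P K t' s' -> reduced Q phi t s = reduced Q phi t' s') ->
  has_formula U P K Q phi.
Proof.
move=> oU UF cst_level.
pose Phi z := reduced Q phi
  (get [set p : R * R | U p /\ zeta P K p.1 p.2 = z]).1
  (get [set p : R * R | U p /\ zeta P K p.1 p.2 = z]).2.
have PhiE t s : U (t, s) -> Phi (zeta P K t s) = reduced Q phi t s.
  move=> Uts; rewrite /Phi; set A := [set p | _].
  have [|] := @getPex _ A; first by exists (t, s).
  by case: (get A) => t' s' /= Ut' zE; exact: cst_level.
exists (cst 0), Phi, (fun t s => - (s * xi Q t)^-1 * phi t s); split.
- by move=> k; exact: Ck_cst.
- move=> k; apply: Ck_locally => z [t [s [Uts ->]]].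
  have /formula_domE[It w0 s0 d0] := UF _ Uts.
  have /near_slice2 := near_level_curve P_cont K_cont oU UF Uts.
  set e := Num.sg s => near_z.
  exists [set z | [/\ U (t, level_s P K e z t), 1 - z * K t != 0 &
    0 < level_w P K z t < t]]^°.
  split; [exact: open_interior|by apply: filterS near_z|].
  set A := (X in interior X).
  have oA : open A^° by exact: open_interior.
  have AA : A^° `<=` A by exact: interior_subset.
  have e1 : e ^+ 2 = 1 by exact: sqr_sg_neq0.
  have Cid : Ck k A^° (fun z : R => z) by exact: Ck_id.
  have Cw : Ck k A^° (level_w P K ^~ t).
    have Cd : Ck k A^° (fun z => 1 - z * K t).
      exact: (CkD oA (Ck_cst k _ (1 : R)) (CkN oA (CkM oA Cid (Ck_cst k _ (K t))))).
    apply: (CkM oA (CkM oA Cid (Ck_cst k _ (expR (P t))))).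
    by apply: (Ck_comp oA _ (Ck_inv R k) Cd) => y /AA[].
  have Csw : Ck k A^° (Num.sqrt \o level_w P K ^~ t).
    by apply: (Ck_comp oA _ (Ck_sqrt R k) Cw) => y /AA[_ _ /andP[]].
  have Cs : Ck k A^° (fun z => level_s P K e z t).
    apply: (CkM oA (Ck_cst k _ (e : R))).
    apply: (Ck_comp oA _ (Ck_sqrt R k) (CkD oA (Ck_cst k _ (t : R)) (CkN oA Cw))).
    by move=> y /AA[_ _ /andP[_]] /=; rewrite subr_gt0.
  have OA y : A^° y -> O (t, level_s P K e y t).
    by move=> /AA[Uy _ _]; exact/formula_dom_O/UF.
  have Cphi := Ck_comp oA OA (smooth_slice phi_smooth t k) Cs.
  have Cphi2 := Ck_comp oA OA (smooth_slice (smooth_d2 phi_smooth) t k) Cs.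
  have Cl := CkD oA Cphi (CkN oA (CkM oA Cs Cphi2)).
  apply: (Ck_ext oA _ (CkM oA (CkM oA Cl Csw) (Ck_cst k _ ((xi Q t)^-1)))) => y Ay.
  have [Uy yK /andP[_ wy]] := AA _ Ay.
  rewrite -[in RHS](zeta_level_s e1 wy yK) PhiE // /reduced level_s_sqr //.
- move=> t s Uts; have /formula_domE[_ w0 s0 _] := UF _ Uts.
  have x0 : xi Q t != 0 by rewrite gt_eqF // expR_gt0.
  have r0 : Num.sqrt (t - s ^+ 2) != 0 by rewrite gt_eqF // sqrtr_gt0.
  have sx0 : s * xi Q t != 0 by rewrite mulf_neq0.
  have dsx := is_deriveM (is_derive_id s 1) (is_derive_cst (xi Q t) s 1).
  have dphi := is_derive_d2 phi_smooth (formula_dom_O (UF _ Uts)).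
  have dV := is_deriveV (f := fun s => s * xi Q t) sx0 dsx.
  apply: is_derive_eq (is_deriveM (is_deriveN dV) dphi) _.
  rewrite PhiE // /reduced /legendre /GRing.scale /= -[(- _) s]/(- (s * xi Q t)^-1).
  rewrite /cst; move: (Num.sqrt _) r0 => r r0.
  by field; rewrite r0 x0 s0.
- move=> t s Uts; have /formula_domE[_ w0 s0 _] := UF _ Uts.
  have x0 : xi Q t != 0 by rewrite gt_eqF // expR_gt0.
  by rewrite /cst; field; rewrite s0 x0.
Qed.

(** On a line of constant t the points outside [formula_dom] are isolated: there
    s = 0, or s^2 = t + e^P / K.  Both sides of the PDE are continuous in s. *)
Lemma pde_extend t s : pde_dom I (t, s) ->
  (\forall y \near s, formula_dom I P K (t, y) -> pde_at c mu nu phi t y) ->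
  pde_at c mu nu phi t s.
Proof.
move=> pts near_pde; have /pde_domE[It t0 st] := pts.
have tI : pos_part I t by split.
have Ots := pde_dom_O pts.
have cid : y @[y --> s] --> s by exact: cvg_id.
have csq : y ^+ 2 @[y --> s] --> s ^+ 2.
  by rewrite expr2; under eq_fun do rewrite expr2; exact: cvgM.
have sphi2 := smooth_d2 phi_smooth.
have c0 : phi t y @[y --> s] --> phi t s := continuous_slice phi_smooth Ots.
have c2 : d2 phi t y @[y --> s] --> d2 phi t s := continuous_slice sphi2 Ots.
have c22 : d2 (d2 phi) t y @[y --> s] --> d2 (d2 phi) t s :=
  continuous_slice (smooth_d2 sphi2) Ots.
have c1 : d1 phi t y @[y --> s] --> d1 phi t s :=
  continuous_slice (smooth_d1 phi_smooth) Ots.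
have c12 : d2 (d1 phi) t y @[y --> s] --> d2 (d1 phi) t s :=
  continuous_slice (smooth_d2 (smooth_d1 phi_smooth)) Ots.
have cA : (nu t - mu t) * y ^+ 2 - nu t * Num.sqrt t ^+ 2 @[y --> s] -->
    (nu t - mu t) * s ^+ 2 - nu t * Num.sqrt t ^+ 2.
  apply: cvgB; [apply: cvgM; [exact: cvg_cst|exact: csq]|exact: cvg_cst].
have cl : pde_lhs c mu nu phi t y @[y --> s] --> pde_lhs c mu nu phi t s.
  apply: cvgM; [apply: cvgD|exact: c22].
    apply: cvgM; [exact: cvg_cst|apply: cvgD; last exact: cvg_cst].
    by apply: cvgM; [exact: cvg_cst|exact: csq].
  apply: cvgM; [exact: cA|apply: cvgB; [exact: cvg_cst|exact: csq]].
have cr : pde_rhs mu nu phi t y @[y --> s] --> pde_rhs mu nu phi t s.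
  apply: cvgB.
    apply: cvgM; [exact: cvg_cst|apply: cvgB; [exact: c1|]].
    by apply: cvgM; [exact: cid|exact: c12].
  apply: cvgM; [exact: cA|apply: cvgB; [exact: c0|]].
  by apply: cvgM; [exact: cid|exact: c2].
have near_dom : \forall y \near s, y != s -> formula_dom I P K (t, y).
  have N1 : \forall y \near s, 0 < t - y ^+ 2.
    have cw : t - y ^+ 2 @[y --> s] --> t - s ^+ 2.
      by apply: cvgB; [exact: cvg_cst|exact: csq].
    by apply: (cvgr_gt _ cw); rewrite subr_gt0.
  have N2 : \forall y \near s, y != s -> y != 0.
    have [s00|s0] := eqVneq s 0; first by apply: filterS N1 => y _; rewrite s00.
    by apply: filterS (cvgr_neq0 _ cid s0) => y.
  have N3 : \forall y \near s, y != s -> zeta_den P K t y != 0.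
    have [d0|d0] := eqVneq (zeta_den P K t s) 0; last first.
      have cd : zeta_den P K t y @[y --> s] --> zeta_den P K t s.
        rewrite /zeta_den; apply: cvgD; first exact: cvg_cst.
        by apply: cvgM; [apply: cvgB; [exact: cvg_cst|exact: csq]|exact: cvg_cst].
      by apply: filterS (cvgr_neq0 _ cd d0) => y.
    have K0 : K t != 0.
      apply/eqP => K0; move/eqP: d0.
      by rewrite /zeta_den K0 mulr0 addr0 gt_eqF // expR_gt0.
    have N4 : \forall y \near s, y != s -> y + s != 0.
      have [s00|s0] := eqVneq s 0.
        by apply: filterS N1 => y _; rewrite s00 addr0.
      have c2s : y + s @[y --> s] --> s + s by apply: cvgD; [exact: cid|exact: cvg_cst].
      have s20 : s + s != 0 by rewrite -mulr2n mulrn_eq0.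
      by apply: filterS (cvgr_neq0 _ c2s s20) => y.
    apply: filterS N4 => y sy ys.
    have -> : zeta_den P K t y = - ((y - s) * (y + s) * K t).
      by rewrite -[LHS]subr0 -d0 /zeta_den; ring.
    by rewrite oppr_eq0 !mulf_neq0 ?sy // subr_eq0.
  apply: filterS3 N1 N2 N3 => y w0 y0 d0 ys; apply/formula_domE.
  by split => //; [exact: y0|exact: d0].
pose H y := pde_lhs c mu nu phi t y - pde_rhs mu nu phi t y.
have E : \forall y \near s^', H y = 0.
  apply: filterS2 near_pde near_dom => y py dy ys.
  by apply/eqP; rewrite subr_eq0; apply/eqP/py/dy.
have H0 : H y @[y --> s^'] --> (0 : R) by exact: cvg_near_cst.
have Hs : H y @[y --> s^'] --> H s.
  by apply: cvg_trans (cvgB cl cr); apply: cvg_app; exact: cvg_within.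
have : H s = 0 by exact: (cvg_unique _ Hs H0).
by move/eqP; rewrite subr_eq0 => /eqP.
Qed.

(** A level of zeta in [U] is locally an arc of one level curve; [reduced] is
    locally constant on it, hence constant by connectedness. *)
Lemma has_formula_unobstructed U : open U -> U `<=` formula_dom I P K ->
  (forall z, connected (U `&` [set p | zeta P K p.1 p.2 = z])) ->
  pde_on U c mu nu phi -> has_formula U P K Q phi.
Proof.
move=> oU UF con pdeU; apply: has_formula_of_level_cst => // t s t' s' Ut Ut' zz.
pose f (p : R * R) := reduced Q phi p.1 p.2.
apply: (@locally_cst_connected _ _ _ f (con (zeta P K t' s')) _ (t', s') (t, s)) => //.
move=> [x y] [Uxy /= <-]; rewrite /f /=.
have /formula_domE[Ix w0 y0 d0] := UF _ Uxy.
have /near_slice1 := near_level_curve P_cont K_cont oU UF Uxy.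
set z := zeta P K x y; set e := Num.sg y => near_x.
have [r /= r0 xr] := near_x.
have cst_r := reduced_curve_cst UF pdeU (sqr_sg_neq0 y0) xr.
have N1 : \forall q \near (x, y), `|x - q.1| < r.
  have c1 : q.1 @[q --> (x, y)] --> x by exact: cvg_fst.
  by move/cvgrPdist_lt: c1; exact.
have N2 : \forall q \near (x, y), Num.sg q.2 = e.
  have c2 : q.2 @[q --> (x, y)] --> y by exact: cvg_snd.
  have [yp|yn|/eqP] := ltgtP y 0; last by rewrite (negPf y0).
    by apply: filterS (cvgr_lt _ c2 _ yp) => q q0; rewrite /e !ltr0_sg.
  by apply: filterS (cvgr_gt _ c2 _ yn) => q q0; rewrite /e !gtr0_sg.
apply: filterS2 N1 N2 => -[x' y'] /= xx' sg' [Uq zq].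
have /formula_domE[_ _ _ d'] := UF _ Uq.
rewrite -(level_s_zeta d') zq sg' cst_r //.
by rewrite /z /e level_s_zeta.
Qed.

(** The neighbourhood is a box in the coordinates (t, zeta), on one side of s = 0.
    Each of its points is joined to the line through [t] by a level curve which
    stays in the domain. *)
Lemma has_formula_near t s : formula_dom I P K (t, s) ->
  pde_on (pde_dom I) c mu nu phi ->
  exists U, [/\ open U, U (t, s), U `<=` formula_dom I P K &
    has_formula U P K Q phi].
Proof.
move=> Fts pdeI; have /formula_domE[It w0 s0 d0] := Fts.
have oF := formula_dom_open I_open P_cont K_cont.
have /nbhs_ballP[r /= r0 qr] := near_level_curve P_cont K_cont oF (fun p h => h) Fts.
set z0 := zeta P K t s in qr; set e := Num.sg s in qr.
have cz p : formula_dom I P K p ->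
    {for p, continuous (fun p : R * R => zeta P K p.1 p.2)}.
  case: p => t' s' /formula_domE[It' _ _ d'].
  rewrite /prop_for /continuous_at /zeta; apply: cvgM.
    apply: cvgB; first exact: cvg_fst.
    by under eq_fun do rewrite expr2; rewrite expr2; apply: cvgM; exact: cvg_snd.
  by apply: cvgV => //; exact: (continuous_zeta_den P_cont K_cont (p := (t', s'))).
pose U := formula_dom I P K `&` [set p | `|t - p.1| < r /\
  (`|z0 - zeta P K p.1 p.2| < r /\ 0 < e * p.2)].
have oU : open U.
  rewrite openE => p [Fp [tp [zp ep]]].
  have N0 : \forall q \near p, formula_dom I P K q by exact: open_nbhs_nbhs.
  have N1 : \forall q \near p, `|t - q.1| < r.
    have c1 : `|t - q.1| @[q --> p] --> `|t - p.1|.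
      by apply: cvg_norm; apply: cvgB; [exact: cvg_cst|exact: cvg_fst].
    exact: (cvgr_lt _ c1).
  have N2 : \forall q \near p, `|z0 - zeta P K q.1 q.2| < r.
    have c1 : `|z0 - zeta P K q.1 q.2| @[q --> p] --> `|z0 - zeta P K p.1 p.2|.
      by apply: cvg_norm; apply: cvgB; [exact: cvg_cst|exact: cz].
    exact: (cvgr_lt _ c1).
  have N3 : \forall q \near p, 0 < e * q.2.
    have c2 : e * q.2 @[q --> p] --> e * p.2.
      by apply: cvgM; [exact: cvg_cst|exact: cvg_snd].
    exact: (cvgr_gt _ c2).
  by near do (split; last split; last split).
have UF : U `<=` formula_dom I P K by move=> p [].
exists U; split => //.
  split; rewrite //= !subrr normr0; do 2 split => //.
  by rewrite /e -normrEsg normr_gt0.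
apply: has_formula_of_level_cst => // t1 s1 t2 s2.
have pdeF : pde_on (formula_dom I P K) c mu nu phi.
  by move=> x y [/pdeI].
have red x y : U (x, y) -> reduced Q phi x y =
    reduced Q phi t (level_s P K e (zeta P K x y) t).
  move=> [Fxy [/= tx [zx ey]]].
  have /formula_domE[_ _ y0 d] := Fxy.
  have curve t' : `|t - t'| < r -> [/\ formula_dom I P K (t', level_s P K e (zeta P K x y) t'),
      1 - zeta P K x y * K t' != 0 & 0 < level_w P K (zeta P K x y) t' < t'].
    by move=> tt'; exact: (qr (t', zeta P K x y)).
  rewrite -(reduced_curve_cst (fun p h => h) pdeF (sqr_sg_neq0 s0) curve tx).
  have -> : Num.sg s = Num.sg y.
    move: ey; rewrite -/e /e; case: (sgrP s) => sgs; rewrite ?mul0r ?ltxx // ?mul1r ?mulN1r.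
      by move=> /gtr0_sg ->.
    by rewrite oppr_gt0 => /ltr0_sg ->.
  by rewrite level_s_zeta.
by move=> U1 U2 zz; rewrite (red _ _ U1) (red _ _ U2) zz.
Unshelve. all: by end_near. Qed.

End GeneralSolution.

(** * Convexity of the Finsler metric *)

(** This is the second derivative of F^2 along the line y + r (e + k y), for y and
    e orthonormal for alpha with beta(y) = s and beta(e) = kap: on this line rho
    is the alpha-norm and m the quotient beta / alpha. *)
Lemma derive_norm_line (R : realType) (f : R -> R) (A : set R) (s k kap : R) :
  open A -> smooth_on A f -> A s ->
  let rho r := Num.sqrt (1 + 2 * k * r + (1 + k ^+ 2) * r ^+ 2) in
  let m r := (s + (kap + k * s) * r) / rho r in
  'D_1 ('D_1 (fun r => (rho r * f (m r)) ^+ 2)) 0 =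
  2 * ((k * f s + kap * derive1 f s) ^+ 2 +
       f s * (f s - s * derive1 f s + kap ^+ 2 * derive1 (derive1 f) s)).
Proof.
move=> oA sf As rho m.
pose q r : R := 1 + 2 * k * r + (1 + k ^+ 2) * r ^+ 2.
pose rho' r := ((1 + k ^+ 2) * r + k) / rho r.
pose la := kap + k * s.
pose m' r := (la - m r * rho' r) / rho r.
have rho0 : rho 0 = 1 by rewrite /rho mulr0 expr0n mulr0 !addr0 sqrtr1.
have m0 : m 0 = s by rewrite /m rho0 mulr0 addr0 divr1.
have rho'0 : rho' 0 = k by rewrite /rho' rho0 mulr0 add0r divr1.
have m'0 : m' 0 = kap by rewrite /m' m0 rho0 rho'0 /la divr1; ring.
have dq (r : R) : is_derive r 1 q (2 * ((1 + k ^+ 2) * r + k)).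
  have D := is_deriveD (is_deriveD (is_derive_cst (1 : R) r 1)
      (is_deriveM (is_derive_cst (2 * k) r 1) (is_derive_id r 1)))
    (is_deriveM (is_derive_cst (1 + k ^+ 2) r 1)
      (is_deriveX 2 (is_derive_id r 1))).
  by apply: is_derive_eq D _; rewrite /GRing.scale /= /cst; ring.
have drho (r : R) : 0 < q r -> is_derive r 1 rho (rho' r).
  move=> q0; apply: is_derive_eq (is_derive1_comp (is_derive1_sqrt q0) (dq r)) _.
  have r0 : rho r != 0 by rewrite gt_eqF // sqrtr_gt0.
  by rewrite /rho' -/(rho r); field.
have dm (r : R) : 0 < q r -> is_derive r 1 m (m' r).
  move=> q0; have r0 : rho r != 0 by rewrite gt_eqF // sqrtr_gt0.
  have dl := is_deriveD (is_derive_cst s r 1)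
    (is_deriveM (is_derive_cst la r 1) (is_derive_id r 1)).
  apply: is_derive_eq (is_deriveM dl (is_deriveV r0 (drho r q0))) _.
  rewrite /GRing.scale /= -[(_ + _) r]/(s + la * r) /m' /m -/la /cst.
  by field.
have df (y : R) : A y -> is_derive y 1 f (derive1 f y).
  have /CkSP[+ _] := sf 1%N => + Ay => /(_ y Ay)/derivable1_diffP Df.
  by rewrite derive1E; exact: derivableP.
have df' (y : R) : A y -> is_derive y 1 (derive1 f) (derive1 (derive1 f) y).
  have /CkSP[_ /(_ 1)/CkSP[+ _]] := sf 2%N => + Ay.
  move=> /(_ y Ay)/derivable1_diffP Df.
  rewrite [derive1 (derive1 f) y]derive1E (_ : (derive1 f) = 'D_1 f); first exact: derivableP.
  by apply/funext => z; rewrite derive1E.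
pose g r := rho r * f (m r).
pose g' r := rho' r * (f (m r) - m r * derive1 f (m r)) + la * derive1 f (m r).
have dg (r : R) : 0 < q r -> A (m r) -> is_derive r 1 g (g' r).
  move=> q0 Am; have r0 : rho r != 0 by rewrite gt_eqF // sqrtr_gt0.
  have D := is_deriveM (drho r q0) (is_derive1_comp (df _ Am) (dm r q0)).
  by apply: is_derive_eq D _; rewrite /GRing.scale /= /g' /m'; field.
have q00 : 0 < q 0 by rewrite /q mulr0 expr0n mulr0 !addr0.
have near_q : \forall r \near (0 : R), 0 < q r.
  exact: (cvgr_gt _ (is_derive_continuous (dq 0))).
have near_A : \forall r \near (0 : R), A (m r).
  apply: (is_derive_continuous (dm 0 q00)).
  by rewrite m0; exact: open_nbhs_nbhs.
have near_D : \forall r \near (0 : R), 'D_1 (fun r => g r ^+ 2) r = 2 * g r * g' r.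
  apply: filterS2 near_q near_A => r qr Ar.
  have D := is_deriveX 2 (dg r qr Ar).
  by have [_ ->] := D; rewrite /GRing.scale /=; ring.
rewrite (near_eq_derive _ near_D).
have Am0 : A (m 0) by rewrite m0.
have drho' : is_derive (0 : R) 1 rho' 1.
  have r0 : rho 0 != 0 by rewrite rho0 oner_eq0.
  have dl := is_deriveD (is_deriveM (is_derive_cst (1 + k ^+ 2) (0 : R) 1) (is_derive_id (0 : R) 1))
    (is_derive_cst k (0 : R) 1).
  apply: is_derive_eq (is_deriveM dl (is_deriveV r0 (drho 0 q00))) _.
  rewrite /GRing.scale /= -[(_ + _) 0]/((1 + k ^+ 2) * 0 + k) rho0 rho'0 /cst.
  by field.
have dfm := is_derive1_comp (df _ Am0) (dm 0 q00).
have df'm := is_derive1_comp (df' _ Am0) (dm 0 q00).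
have dg' := is_deriveD (is_deriveM drho' (is_deriveB dfm (is_deriveM (dm 0 q00) df'm)))
   (is_deriveM (is_derive_cst la (0 : R) 1) df'm).
have D := is_deriveM (is_deriveM (is_derive_cst (2 : R) (0 : R) 1) (dg 0 q00 Am0)) dg'.
have [_ E] := D; rewrite [LHS]E.
rewrite /GRing.scale /=.
rewrite -[(cst 2 * g) 0]/(2 * g 0).
rewrite -[X in _ + X * (2 * g' 0 + _)]/(rho' 0 * (f (m 0) - m 0 * (derive1 f (m 0))) +
  la * (derive1 f (m 0))).
rewrite -[X in _ * (_ + X * 1 + _)]/(f (m 0) - m 0 * (derive1 f (m 0))).
rewrite /g' /g rho0 rho'0 m'0 m0 /la.
by ring.
Qed.

Section BilinearForm.
Variables (R : realType) (n : nat).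
Implicit Types (A : 'M[R]_n) (u v w : 'rV[R]_n).

Lemma bilinDl A u v w : bilin A (u + v) w = bilin A u w + bilin A v w.
Proof. by rewrite /bilin !mulmxDl mxE. Qed.

Lemma bilinZl A k u v : bilin A (k *: u) v = k * bilin A u v.
Proof. by rewrite /bilin -!scalemxAl mxE. Qed.

Lemma bilinC A u v : A^T = A -> bilin A u v = bilin A v u.
Proof.
move=> sA; rewrite /bilin -(trmxK (u *m A *m v^T)) mxE !trmx_mul trmxK sA.
by rewrite mulmxA.
Qed.

Lemma bilinDr A u v w : bilin A u (v + w) = bilin A u v + bilin A u w.
Proof. by rewrite /bilin linearD mulmxDr mxE. Qed.

Lemma bilinZr A k u v : bilin A u (k *: v) = k * bilin A u v.
Proof. by rewrite /bilin linearZ -scalemxAr mxE. Qed.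

Lemma pairingDr u v w : pairing u (v + w) = pairing u v + pairing u w.
Proof. by rewrite /pairing linearD mulmxDr mxE. Qed.

Lemma pairingZr k u v : pairing u (k *: v) = k * pairing u v.
Proof. by rewrite /pairing linearZ -scalemxAr mxE. Qed.

Lemma posdef_unit A : posdef A -> A \in unitmx.
Proof.
move=> pA; rewrite -row_free_unit -kermx_eq0; apply: contraT => /rowV0Pn[u].
move=> /sub_kermxP uA /pA; by rewrite /bilin uA mul0mx mxE ltxx.
Qed.

Lemma kernel_vector m (M : 'M[R]_(n, m)) : (m < n)%N ->
  exists2 u : 'rV_n, u != 0 & u *m M = 0.
Proof.
move=> mn; have : kermx M != 0.
  rewrite kermx_eq0 /row_free neq_ltn (leq_ltn_trans (rank_leq_col M)) //.
by move=> /rowV0Pn[u /sub_kermxP uM u0]; exists u.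
Qed.

Lemma posdef_normalize A u : posdef A -> u != 0 ->
  exists k : R, bilin A (k *: u) (k *: u) = 1.
Proof.
move=> pA /pA u0; exists (Num.sqrt (bilin A u u))^-1.
rewrite bilinZl bilinZr mulrA -invfM -expr2 sqr_sqrtr ?(ltW u0) //.
by rewrite mulVf // gt_eqF.
Qed.

End BilinearForm.

(** With B the vector dual to the form b and v a unit vector in its kernel, y and e
    are obtained by a rotation in the plane of B and v.  Then w must be orthogonal
    to v and in the kernel of b: two linear conditions, whence 3 <= n. *)
Lemma adapted_frame (R : realType) (n : nat) (A : 'M[R]_n) (b : 'rV[R]_n)
    (t s : R) : (3 <= n)%N -> A^T = A -> posdef A -> t = bilin (invmx A) b b ->
  0 < t -> s ^+ 2 < t -> exists y e w : 'rV[R]_n,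
  [/\ bilin A y y = 1 /\ pairing b y = s,
      [/\ bilin A e e = 1, bilin A y e = 0 & pairing b e = Num.sqrt (t - s ^+ 2)] &
      [/\ bilin A w w = 1, bilin A y w = 0 & pairing b w = 0]].
Proof.
move=> n3 sA pA tE t0 st.
have uA := posdef_unit pA.
pose B := b *m invmx A.
have BE v : bilin A B v = pairing b v by rewrite /bilin /B mulmxKV.
have bB : pairing b B = t.
  by rewrite tE /pairing /bilin /B trmx_mul trmx_inv sA mulmxA.
have [v0 v00 bv0] := kernel_vector b^T (leq_trans (isT : 1 < 3)%N n3).
have [kv vv] := posdef_normalize pA v00.
set v := kv *: v0 in vv.
have bv : pairing b v = 0.
  rewrite /v pairingZr /pairing -[b]trmxK -trmx_mul bv0 trmx0 mxE mulr0 //.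
have [w0 w00 ww0] := kernel_vector (row_mx b^T (v *m A)^T) n3.
have [kw ww] := posdef_normalize pA w00.
set w := kw *: w0 in ww.
move: ww0; rewrite mul_mx_row -[0]row_mx0 => /eq_row_mx[bw0 vw0].
have bw : pairing b w = 0.
  rewrite /w pairingZr /pairing -[b]trmxK -trmx_mul bw0 trmx0 mxE mulr0 //.
have vw : bilin A v w = 0.
  by rewrite /w bilinZr /bilin -[v *m A]trmxK -trmx_mul vw0 trmx0 mxE mulr0.
have vB : bilin A v B = 0 by rewrite bilinC // BE.
have wB : bilin A B w = 0 by rewrite BE.
have Bv : bilin A B v = 0 by rewrite BE.
have BB : bilin A B B = t by rewrite BE.
clearbody v w B.
pose r := Num.sqrt (t - s ^+ 2); pose d := Num.sqrt t.
have r2 : r ^+ 2 = t - s ^+ 2 by rewrite sqr_sqrtr // subr_ge0 ltW.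
have td : t = d ^+ 2 by rewrite sqr_sqrtr // ltW.
have d0 : d != 0 by rewrite gt_eqF // sqrtr_gt0.
have tn0 : t != 0 by rewrite gt_eqF.
exists (s / t *: B + r / d *: v), (r / t *: B + - (s / d) *: v), w.
rewrite !(bilinDl, bilinDr, bilinZl, bilinZr, pairingDr, pairingZr).
rewrite bB bv bw vv vw vB wB Bv BB ww -/r !mulr0 !addr0 !add0r.
have tr : t = s ^+ 2 + r ^+ 2 by rewrite r2 addrC subrK.
rewrite td in tr *; clearbody d; move: (r) (r2) tr => {r2}r _ tr.
have d20 : d ^+ 2 != 0 by rewrite expf_neq0.
have quad x y : x ^+ 2 + y ^+ 2 = d ^+ 2 ->
    x / d ^+ 2 * (x / d ^+ 2 * d ^+ 2) + y / d * (y / d) = 1.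
  by move=> E; rewrite -(divff d20) -{4}E; field.
split; split => //.
- by rewrite mulr1 quad.
- by rewrite divfK.
- by rewrite mulr1 mulrNN quad // addrC.
- by field.
- by rewrite divfK.
Qed.

Lemma sum_delta_derive (R : realType) (n : nat) (f : 'rV[R]_n -> R)
    (u y : 'rV[R]_n) : differentiable f y ->
  \sum_j u 0 j * 'D_(delta_mx 0 j) f y = 'D_u f y.
Proof.
move=> df; rewrite deriveE // {2}(row_sum_delta u) linear_sum.
by apply: eq_bigr => j _; rewrite linearZ deriveE.
Qed.

Lemma bilin_fundamental (R : realType) (n : nat) (M : manifold R n)
    (F : chart M -> 'rV[R]_n -> 'rV[R]_n -> R) (a : chart M)
    (x y u : 'rV[R]_n) (U : set 'rV[R]_n) :
  open U -> U y -> Ck 2 U (fun y => F a x y ^+ 2) ->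
  bilin (fundamental_tensor F a x y) u u =
  2^-1 * 'D_u ('D_u (fun y => F a x y ^+ 2)) y.
Proof.
move=> oU Uy; set f := (fun y => _) => cf.
have /CkSP[df Df] := cf.
have ddf v : differentiable ('D_v f) y by have /CkSP[+ _] := Df v; exact.
rewrite -(sum_delta_derive u (ddf u)) mulr_sumr /bilin mxE.
apply: eq_bigr => i _.
rewrite (deriveC _ _ oU Uy cf) -(sum_delta_derive u (ddf _)) !mxE.
rewrite mulr_suml mulr_sumr mulr_sumr; apply: eq_bigr => j _.
rewrite !mxE /pd -/f (deriveC _ _ oU Uy cf); ring.
Qed.

(** F^2 is tested in the direction e + k y, where k makes the first derivative of
    F along the line vanish; what remains of the second derivative of F^2 / 2 is
    F F'', and the second derivative of F does not depend on k. *)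
Lemma gab_convex (R : realType) (n : nat) (M : manifold R n)
    (al : chart M -> 'rV[R]_n -> 'M[R]_n) (be : chart M -> 'rV[R]_n -> 'rV[R]_n)
    (I : set R) (phi : R -> R -> R) (F : chart M -> 'rV[R]_n -> 'rV[R]_n -> R)
    (a : chart M) (x y e : 'rV[R]_n) (s kap : R) :
  general_ab_metric al be I phi F -> cimg a x ->
  bilin (al a x) y y = 1 -> bilin (al a x) e e = 1 -> bilin (al a x) y e = 0 ->
  pairing (be a x) y = s -> pairing (be a x) e = kap ->
  let t := bsq al be a x in s ^+ 2 <= t ->
  0 < phi t s - s * d2 phi t s + kap ^+ 2 * d2 (d2 phi) t s.
Proof.
move=> [Fin [[_ sym pos _] _] [[W [oW WI sphi]] phi0] FE] xa yy ee ye ys ek t st.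
have [It {}FE] := FE a x xa.
have [_ [Fsm Ffin]] := Fin; have [_ _ _ /(_ y) gpos] := Ffin a x xa.
have y0 : y != 0.
  by apply/eqP => y0; move/eqP: yy; rewrite y0 /bilin !mul0mx mxE eq_sym oner_eq0.
have phits := phi0 t s It st.
pose k := - (kap * d2 phi t s) / phi t s.
pose u := e + k *: y.
have sA := sym a x xa.
have ey : bilin (al a x) e y = 0 by rewrite bilinC.
have uu : bilin (al a x) u u = 1 + k ^+ 2.
  rewrite /u !(bilinDl, bilinDr, bilinZl, bilinZr) yy ee ye ey; ring.
have u0 : u != 0.
  apply/eqP => u0; move: uu; rewrite u0 /bilin !mul0mx mxE => /eqP.
  by rewrite eq_sym gt_eqF // ltr_wpDr // sqr_ge0.
have := gpos y0 u u0.
have oY : open [set y : 'rV[R]_n | y != 0].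
  rewrite (_ : [set y | _] = ~` [set 0]).
    exact/closed_openC/accessible_closed_set1/hausdorff_accessible/norm_hausdorff.
  by apply/seteqP; split => z /= /eqP.
have CF : Ck 2 [set y : 'rV[R]_n | y != 0] (F a x).
  by apply: Ck_sub (Ck_slice x (Fsm a 2%N)) => z z0.
have CF2 : Ck 2 [set y : 'rV[R]_n | y != 0] (fun y => F a x y ^+ 2).
  by apply: (Ck_ext oY _ (CkM oY CF CF)) => z _; rewrite expr2.
rewrite (bilin_fundamental u oY y0 CF2).
set f := (fun y => _ ^+ 2).
have -> : 'D_u ('D_u f) y = 'D_1 ('D_1 (fun r : R => f (y + r *: u))) 0.
  have -> : 'D_1 (fun r : R => f (y + r *: u)) = fun r => 'D_u f (y + r *: u).
    by apply/funext => r; exact: derive_line.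
  by rewrite (derive_line ('D_u f) y u 0) scale0r addr0.
pose A := [set s | W (t, s)].
have As : A s by exact: WI.
have oA : open A.
  rewrite openE => z Az.
  exact: (@near_slice2 _ _ W t z (open_nbhs_nbhs (conj oW Az))).
have sA' : smooth_on A (phi t) by exact: smooth_slice.
have yu : bilin (al a x) y u = k by rewrite /u bilinDr bilinZr ye yy; ring.
have uy : bilin (al a x) u y = k by rewrite bilinC.
have bu : pairing (be a x) u = kap + k * s by rewrite /u pairingDr pairingZr ek ys.
have Q r : bilin (al a x) (y + r *: u) (y + r *: u) =
    1 + 2 * k * r + (1 + k ^+ 2) * r ^+ 2.
  clearbody u; rewrite !(bilinDl, bilinDr, bilinZl, bilinZr) yy yu uy uu; ring.
have L r : pairing (be a x) (y + r *: u) = s + (kap + k * s) * r.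
  by rewrite pairingDr pairingZr ys bu mulrC.
have E := derive_norm_line k kap oA sA' As.
have fE : (fun r : R => f (y + r *: u)) =
    (fun r => (Num.sqrt (1 + 2 * k * r + (1 + k ^+ 2) * r ^+ 2) *
      phi t ((s + (kap + k * s) * r) /
       Num.sqrt (1 + 2 * k * r + (1 + k ^+ 2) * r ^+ 2))) ^+ 2).
  apply/funext => r; rewrite /f FE; first by rewrite /alpha /beta Q L.
  (* the square of the norm on the line is positive, so the line avoids 0 *)
  apply/eqP => yr0; have /eqP := Q r; rewrite yr0 /bilin !mul0mx mxE.
  rewrite (_ : _ + _ = (1 + k * r) ^+ 2 + r ^+ 2); last by ring.
  rewrite eq_sym paddr_eq0 ?sqr_ge0 // !sqrf_eq0 => /andP[/eqP kr /eqP r0].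
  by move/eqP: kr; rewrite r0 mulr0 addr0 oner_eq0.
rewrite fE E mulrA mulVf ?mul1r ?pnatr_eq0 //.
have -> : k * phi t s + kap * derive1 (phi t) s = 0.
  by rewrite /k /d2 divfK ?gt_eqF // addNr.
by rewrite expr0n add0r pmulr_rgt0.
Qed.

Section Convexity.
Variables (R : realType) (I : set R) (P K Q : R -> R).
Variables (phi : R -> R -> R) (O : set (R * R)).
Hypothesis phi_smooth : smooth_on O (fun p => phi p.1 p.2).
Variables (U : set (R * R)) (h Phi : R -> R) (G : R -> R -> R).
Hypotheses (U_open : open U) (U_dom : U `<=` formula_dom I P K) (U_O : U `<=` O).
Hypothesis phi_formula : formula_on U P K Q phi h Phi G.
Implicit Types t s : R.

Lemma legendre_formula t s : U (t, s) ->
  Phi (zeta P K t s) / Num.sqrt (t - s ^+ 2) = legendre phi t s / xi Q t.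
Proof.
move=> Uts; rewrite -(reduced_formula U_open U_dom phi_formula Uts).
have /formula_domE[_ w0 _ _] := U_dom Uts.
have r0 : Num.sqrt (t - s ^+ 2) != 0 by rewrite gt_eqF // sqrtr_gt0.
by rewrite /reduced mulrAC mulfK.
Qed.

Lemma is_derive_zeta t s : zeta_den P K t s != 0 ->
  is_derive s 1 (zeta P K t) (- (2 * s * expR (P t) / zeta_den P K t s ^+ 2)).
Proof.
move=> d0.
have dw := is_deriveB (is_derive_cst t s 1) (is_deriveX 2 (is_derive_id s 1)).
have dd := is_deriveD (is_derive_cst (expR (P t)) s 1)
  (is_deriveM dw (is_derive_cst (K t) s 1)).
apply: is_derive_eq (is_deriveM dw (is_deriveV (f := zeta_den P K t) d0 dd)) _.
rewrite /GRing.scale /= -[(_ - _) s]/(t - s ^+ 2) /cst.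
rewrite /zeta_den in d0 *.
by field.
Qed.

(** The identity Psi = Phi(zeta) differentiated in s; both sides carry a factor
    - s, which is cancelled. *)
Lemma derive1_formula t s : U (t, s) ->
  derive1 Phi (zeta P K t s) * Num.sqrt (t - s ^+ 2)
    * (2 * expR (P t) / zeta_den P K t s ^+ 2)
  = (legendre phi t s + (t - s ^+ 2) * d2 (d2 phi) t s) / xi Q t.
Proof.
move=> Uts; have /formula_domE[_ w0 s0 d0] := U_dom Uts.
have r0 : 0 < Num.sqrt (t - s ^+ 2) by rewrite sqrtr_gt0.
have x0 : xi Q t != 0 by rewrite gt_eqF // expR_gt0.
have dw := is_deriveB (is_derive_cst t s 1) (is_deriveX 2 (is_derive_id s 1)).
have dr := is_derive1_comp (f := Num.sqrt) (g := fun s => t - s ^+ 2)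
  (is_derive1_sqrt w0) dw.
have dl := is_derive_legendre2 phi_smooth (U_O Uts).
have D1 := is_deriveM (is_deriveM dl dr) (is_derive_cst (xi Q t)^-1 s 1).
have dPhi : is_derive (zeta P K t s) 1 Phi (derive1 Phi (zeta P K t s)).
  have [_ /(_ 1%N)/CkSP[+ _] _ _] := phi_formula.
  move=> /(_ (zeta P K t s) (ex_intro _ t (ex_intro _ s (conj Uts erefl)))).
  by move=> /derivable1_diffP dP; rewrite derive1E; exact: derivableP.
have D2 := is_derive1_comp (g := zeta P K t) dPhi (is_derive_zeta d0).
have N : \forall y \near s, (Phi \o zeta P K t) y =
    (legendre phi t * (Num.sqrt \o (fun s => t - s ^+ 2)) * cst (xi Q t)^-1) y.
  have : \forall y \near s, U (t, y).
    exact: (near_slice2 (open_nbhs_nbhs (conj U_open Uts))).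
  by apply: filterS => y Uy /=; rewrite -(reduced_formula U_open U_dom phi_formula Uy).
have [_ E1] := near_eq_is_derive N D2.
have [_] := D1; rewrite E1 => {E1}.
rewrite /GRing.scale /= -[(_ * _) s]/(legendre phi t s * Num.sqrt (t - s ^+ 2)).
set D := derive1 Phi _; set den := zeta_den P K t s in d0 *.
have ww : t - s ^+ 2 = Num.sqrt (t - s ^+ 2) ^+ 2 by rewrite sqr_sqrtr // ltW.
rewrite [X in _ = (_ + X * _) / _]ww.
have {}r0 : Num.sqrt (t - s ^+ 2) != 0 by rewrite gt_eqF.
move: (Num.sqrt (t - s ^+ 2)) r0 => r r0 E.
apply: (mulfI s0).
have -> : s * (D * r * (2 * expR (P t) / den ^+ 2)) =
  - r * (D * - (2 * s * expR (P t) / den ^+ 2)) by field.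
by rewrite E; field; rewrite x0 r0.
Qed.

End Convexity.

(** * The general solution *)

Unset Implicit Arguments.
Set Strict Implicit.
Set Printing Implicit Defensive.

Theorem theorem1p2 (R : realType) (n : nat) (n_ge3 : (3 <= n)%N)
  (M : manifold R n)
  (al : chart M -> 'rV[R]_n -> 'M[R]_n)
  (be : chart M -> 'rV[R]_n -> 'rV[R]_n)
  (F : chart M -> 'rV[R]_n -> 'rV[R]_n -> R)
  (I : set R) (I_open : open I) (I_interval : is_interval I)
  (phi : R -> R -> R)
  (F_gab : general_ab_metric al be I phi F)
  (F_nonriemannian : ~ is_riemannian F)
  (be_nonparallel : ~ parallel al be)
  (c mu nu : R -> R)
  (c_smooth : smooth_on (pos_part I) c)
  (mu_smooth : smooth_on (pos_part I) mu)
  (nu_smooth : smooth_on (pos_part I) nu)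
  (P K Q : R -> R)
  (PKQ : integrals I c mu nu P K Q) :
  (* the formula is the general solution of the PDE, locally *)
  (pde_on (pde_dom I) c mu nu phi <->
   forall p, formula_dom I P K p ->
     exists U : set (R * R),
       [/\ open U, U p, U `<=` formula_dom I P K & has_formula U P K Q phi])
  (* every function given by the formula is a solution, also at s = 0 *)
  /\ (forall U : set (R * R), open U -> U `<=` pde_dom I ->
        has_formula (U `&` formula_dom I P K) P K Q phi ->
        pde_on U c mu nu phi)
  (* every solution is given by the formula, with the same h and Phi as long
     as the characteristic curves are not disconnected *)
  /\ (forall U : set (R * R), open U -> U `<=` formula_dom I P K ->
        unobstructed U P K -> pde_on U c mu nu phi ->
        has_formula U P K Q phi)
  (* consequences of the positive definiteness of F *)
  /\ (forall (U : set (R * R)) (h Phi : R -> R) (G : R -> R -> R),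
        open U -> U `<=` formula_dom I P K ->
        formula_on U P K Q phi h Phi G ->
        forall a x s, cimg a x -> U (bsq al be a x, s) ->
          let t := bsq al be a x in
          0 < Phi (zeta P K t s) / Num.sqrt (t - s ^+ 2) /\
          0 < derive1 Phi (zeta P K t s) * Num.sqrt (t - s ^+ 2)).
Proof.
have [_ [[_ al_sym al_pos _] _] [[W [oW WI sphi]] _] _] := F_gab.
have IW : pde_dom I `<=` W.
  by move=> [t s] /pde_domE[It _ /ltW st]; exact: WI.
have FI : formula_dom I P K `<=` pde_dom I by move=> p [].
have P_cont t : pos_part I t -> {for t, continuous P}.
  by have [dP _ _] := PKQ => /dP; exact: is_derive_continuous.
have K_cont t : pos_part I t -> {for t, continuous K}.
  by have [_ dK _] := PKQ => /dK; exact: is_derive_continuous.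
split; [split|split; [|split]].
- move=> pdeI [t s] Fts; exact: (has_formula_near I_open PKQ oW sphi IW).
- move=> loc t s pts; apply: (pde_extend (P := P) (K := K) sphi IW pts).
  apply: (@filterE _ (nbhs s) (nbhs_filter s)) => y Fty.
  have [U [oU Uty UF hU]] := loc _ Fty.
  exact: (pde_of_formula PKQ oW sphi IW oU UF hU).
- move=> U oU UI hU t s Uts; apply: (pde_extend (P := P) (K := K) sphi IW (UI _ Uts)).
  have : \forall y \near s, U (t, y).
    exact: (near_slice2 (open_nbhs_nbhs (conj oU Uts))).
  apply: filterS => y Uty Fty.
  have oUF : open (U `&` formula_dom I P K).
    by apply: openI => //; exact: (formula_dom_open I_open P_cont K_cont).
  have UFF : U `&` formula_dom I P K `<=` formula_dom I P K by move=> p [].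
  exact: (pde_of_formula PKQ oW sphi IW oUF UFF hU (conj Uty Fty)).
- move=> U oU UF [con _] pdeU.
  exact: (has_formula_unobstructed PKQ oW sphi IW).
- move=> U h Phi G oU UF fU a x s xa Uts t.
  have [[It t0] w0 _ d0] := (formula_domE I P K t s).1 (UF _ Uts).
  have st : s ^+ 2 < t by rewrite -subr_gt0.
  have [y [e [w [[yy ys] [ee ye es] [ww yw ws]]]]] :=
    adapted_frame n_ge3 (al_sym a x xa) (al_pos a x xa) erefl t0 st.
  have := gab_convex F_gab xa yy ww yw ys ws (ltW st).
  have := gab_convex F_gab xa yy ee ye ys es (ltW st).
  rewrite expr0n mul0r addr0 sqr_sqrtr ?(ltW w0) // -/(legendre phi t s).
  move=> conv2 conv1.
  have UW : U `<=` W by move=> p /UF/FI/IW.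
  have x0 : 0 < xi Q t by exact: expR_gt0.
  split; first by rewrite (legendre_formula oU UF fU Uts) divr_gt0.
  have k0 : 0 < 2 * expR (P t) / zeta_den P K t s ^+ 2.
    by apply: divr_gt0; [rewrite mulr_gt0 ?expR_gt0|rewrite exprn_even_gt0].
  by rewrite -(pmulr_lgt0 _ k0) (derive1_formula sphi oU UF UW fU Uts) divr_gt0.
Qed.
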